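(* Let $k$ be an algebraically closed field of characteristic $p>0$. Let $d,e_1,e_2,e_3$ be positive integers with $2d-2=\sum_{i=1}^3(e_i-1)$, each $e_i$ prime to $p$, and $e_i\le d$ for all $i$, and let $Q_1,Q_2,Q_3$ be distinct points on $\mathbb{P}^1$ (over $k$). Then the triple $(e_1,e_2,e_3)$ is numerically $p$-admissible if and only if there exists a (necessarily unique up to automorphism) separable cover $f:\mathbb{P}^1\to\mathbb{P}^1$ of degree $d$, branched over each $Q_i$ with a single ramification point of index $e_i$.
   Context: **Notation.** For a positive integer $e$ prime to $p$ and $m>0$: $\bar e^{[m,u]}=\lceil e/p^m\rceil$, $\bar e^{[m,d]}=\lfloor e/p^m\rfloor$, $e^{[m,u]}=p^m\bar e^{[m,u]}-e$, $e^{[m,d]}=e-p^m\bar e^{[m,d]}$ (the letters $u$, $d$ in the superscripts are just symbols for ''up'', ''down''). **Numerical $p$-admissibility for triples.** Given positive integers $(e_1,e_2,e_3)$ prime to $p$, satisfying the triangle inequality ($e_1\le e_2+e_3$, $e_2\le e_1+e_3$, $e_3\le e_1+e_2$), and with $e_1+e_2+e_3$ odd, let $d$ be the integer with $2d-2=\sum_i(e_i-1)$. (The triangle inequality is equivalent to $e_i\le d$ for all $i$.) The triple is numerically $p$-admissible if for every integer $m>0$ and every $S\subseteq\{1,2,3\}$ such that (i) $p^m\le d$; (ii) $e_i>p^m$ for all $i\in S$; (iii) $\sum_{i\in S}\bar e_i^{[m,d]}+\sum_{i\notin S}\bar e_i^{[m,u]}$ is odd, one has $$\sum_{i\in S}e_i^{[m,d]}+\sum_{i\notin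 S}e_i^{[m,u]}\ge p^m.$$ Covers are considered up to automorphism of the source $\mathbb{P}^1$. *)

(* Defs.v *)
From HB Require Import structures.
From mathcomp Require Import all_boot all_order all_algebra all_field.

Set Implicit Arguments.
Unset Strict Implicit.
Unset Printing Implicit Defensive.

Import GRing.Theory.
Local Open Scope ring_scope.

(* For k algebraically closed, the closed points of the projective line:
   [Some a] is (a : 1) and [None] is the point at infinity (1 : 0). *)
Definition P1 (k : Type) := option k.

(* A morphism P^1 -> P^1 in lowest terms, x |-> (num x : den x); the two
   polynomials are determined up to a common nonzero scalar.  [den = 0] is
   allowed ([num] is then a nonzero constant) and gives the constant map with
   value infinity. *)
Record ratmap (k : fieldType) := RatMap {
  num : {poly k};
  den : {poly k};
  num_den_coprime : coprimep num den
}.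

Section RationalMaps.

Variable k : fieldType.
Implicit Types (f g s t : ratmap k) (P Q : P1 k) (N D : {poly k}).

(* The degree of the two coprime binary forms defining the morphism. *)
Definition degree f : nat := (maxn (size (num f)) (size (den f))).-1.

Definition proj_point (a b : k) : P1 k := if b == 0 then None else Some (a / b).

(* The value at infinity is given by the coefficients in degree [degree f]. *)
Definition eval f P : P1 k :=
  match P with
  | Some a => proj_point (num f).[a] (den f).[a]
  | None => proj_point (num f)`_(degree f) (den f)`_(degree f)
  end.

(* Order of vanishing at P of the rational function N / D, for N, D != 0. *)
Definition ord P N D : int :=
  match P with
  | Some a => (mup a N)%:Z - (mup a D)%:Z
  | None => (size D)%:Z - (size N)%:Z
  end.

(* e_P(f) = ord_P (f^* u) for a uniformizer u at f(P): u = y - c if f(P) is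
   the finite point c, and u = 1 / y if f(P) is infinity.  Only meaningful
   for nonconstant f. *)
Definition ram_index f P : int :=
  match eval f P with
  | Some c => ord P (num f - c *: den f) (den f)
  | None => ord P (den f) (num f)
  end.

(* Q has exactly one preimage of ramification index e, all the other
   preimages being unramified; for e = 1 this says f is unramified over Q. *)
Definition single_ramification_over f Q (e : nat) : Prop :=
  exists P, [/\ eval f P = Q, ram_index f P = e%:Z &
    forall P', eval f P' = Q -> P' <> P -> ram_index f P' = 1].

Definition function_of f : {fraction {poly k}} :=
  tofrac (num f) / tofrac (den f).

Definition subst_poly (h : {poly k}) (y : {fraction {poly k}}) :
    {fraction {poly k}} :=
  (map_poly (fun c : k => tofrac c%:P) h).[y].

(* The subfield k(f) of k(x), i.e. the image of f^* : k(t) -> k(x). *)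
Definition pullback_field f (u : {fraction {poly k}}) : Prop :=
  exists A B : {poly k}, subst_poly B (function_of f) != 0 /\
    u = subst_poly A (function_of f) / subst_poly B (function_of f).

(* The extension k(x) / k(f) of function fields is separable algebraic. *)
Definition separable_ratmap f : Prop :=
  forall u : {fraction {poly k}}, exists q : {poly {fraction {poly k}}},
    [/\ forall i : nat, pullback_field f q`_i, separable_poly q & root q u].

Definition automorphism s : Prop :=
  exists t, cancel (eval s) (eval t) /\ cancel (eval t) (eval s).

Definition is_cover (d : nat) (e : 'I_3 -> nat) (Q : 'I_3 -> P1 k) f : Prop :=
  [/\ degree f = d, separable_ratmap f &
      forall i, single_ramification_over f (Q i) (e i)].

End RationalMaps.

Section Admissibility.

Local Open Scope nat_scope.

Variable p : nat.

Definition bar_down (m e : nat) : nat := e %/ p ^ m.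
Definition bar_up (m e : nat) : nat := (e + (p ^ m).-1) %/ p ^ m. (* ceiling *)
Definition rem_down (m e : nat) : nat := e - p ^ m * bar_down m e.
Definition rem_up (m e : nat) : nat := p ^ m * bar_up m e - e.

(* Here d stands for the integer with 2d - 2 = \sum_i (e_i - 1). *)
Definition numerically_admissible (d : nat) (e : 'I_3 -> nat) : Prop :=
  forall (m : nat) (S : {set 'I_3}), 0 < m ->
    p ^ m <= d ->
    (forall i, i \in S -> p ^ m < e i) ->
    odd (\sum_(i in S) bar_down m (e i) + \sum_(i in ~: S) bar_up m (e i)) ->
    p ^ m <= \sum_(i in S) rem_down m (e i) + \sum_(i in ~: S) rem_up m (e i).

End Admissibility.

(* Main.v *)
Require Import Defs.
From HB Require Import structures.
From mathcomp Require Import all_boot all_order all_algebra all_field.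
From mathcomp Require Import zify ring.

Set Implicit Arguments.
Unset Strict Implicit.
Unset Printing Implicit Defensive.

Import GRing.Theory.
Local Open Scope ring_scope.

(* Fix distinct points P_i.  A pair (N, D) of forms of degree d such that the
   pullback of Q_i vanishes to order e_i at P_i is subject to
   \sum e_i = 2 d + 1 linear conditions on 2 d + 2 coefficients, so a nonzero
   pair exists; and N / D is unique, because the form N D' - N' D of degree 2 d
   attached to two pairs vanishes to order e_i at each P_i.

   Let H be the gcd of N and D, and write N / H and D / H as q-th powers of F
   and G, with q = p^m and F / G separable of degree delta.  If F / G has
   ramification eps_i over the (Frobenius twisted) Q_i at P_i, then
   Riemann-Hurwitz for F / G together with deg H <= d - q delta forces
   \sum |q eps_i - e_i| < q and \sum eps_i = 2 delta + 1.  If q = 1, then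
   F / G is the cover; if q > 1, then S = {i | q eps_i < e_i} violates
   admissibility.  Conversely a violation (m, S) prescribes eps_i, and the pair
   of forms with these orders, raised to the power p^m and multiplied by the
   missing zeros at P_i, is an inseparable pair for (e_i), which excludes a
   separable one by uniqueness. *)

(* Generalizing the sizes first identifies the displayed forms of size that
   are convertible but not syntactically equal. *)
Ltac size_lia :=
  intros;
  repeat match goal with H : is_true _ |- _ => revert H end;
  repeat match goal with
  | |- context[@size ?T (@polyseq ?R ?F)] => move: (@size T (@polyseq R F)) => ?
  end;
  lia.

(** * Binary forms and their vanishing orders *)

(* A binary form of degree n is represented by the polynomial F of size at
   most n.+1 obtained by dehomogenizing; what is missing from the degree is
   the order of vanishing at infinity. *)
Definition vanishes (k : fieldType) n (P : P1 k) e (F : {poly k}) : bool :=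
  match P with
  | Some a => ('X - a%:P) ^+ e %| F
  | None => (size F <= n.+1 - e)%N
  end.

(** Meaningful for nonzero forms only; [vanishes] is kept beside it as a linear condition that the
    zero form satisfies at every order. *)
Definition form_ord (k : fieldType) n (P : P1 k) (F : {poly k}) : nat :=
  match P with
  | Some a => mup a F
  | None => n.+1 - size F
  end.

(* The form whose zeros are the preimages of Q under (N : D). *)
Definition fiber_form (k : fieldType) (Q : P1 k) (N D : {poly k}) : {poly k} :=
  if Q is Some c then N - c *: D else D.

(** The numerator of the derivative of [F / G]. For forms of degree d it represents a form of degree
    2 d - 2, whose zeros control the ramification of [F / G]. *)
Definition wronskian (k : fieldType) (F G : {poly k}) : {poly k} :=
  F^`() * G - F * G^`().

Section Forms.

Variable k : fieldType.
Implicit Types (P Q : P1 k) (F G N D H : {poly k}).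

Lemma vanishesE n P e F : F != 0 -> (size F <= n.+1)%N ->
  vanishes n P e F = (e <= form_ord n P F)%N.
Proof.
case: P => [a|] F0 sF /=; first by rewrite mup_geq.
by move: F0; rewrite -size_poly_gt0; size_lia.
Qed.

Lemma vanishes0 n P e : vanishes n P e 0.
Proof. by case: P => [a|] /=; rewrite ?dvdp0 // size_poly0. Qed.

Lemma vanishesD n P e F G :
  vanishes n P e F -> vanishes n P e G -> vanishes n P e (F + G).
Proof.
case: P => [a|] /=; first exact: dvdp_add.
by move=> sF sG; rewrite (leq_trans (size_polyD _ _)) // geq_max sF.
Qed.

Lemma vanishesZ n P e c F : vanishes n P e F -> vanishes n P e (c *: F).
Proof.
case: P => [a|] /=; last exact/leq_trans/size_scale_leq.
by rewrite -mul_polyC; apply: dvdp_mull.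
Qed.

Lemma vanishesN n P e F : vanishes n P e F -> vanishes n P e (- F).
Proof. by rewrite -scaleN1r; apply: vanishesZ. Qed.

Lemma size_formM F G m n : (size F <= m.+1)%N -> (size G <= n.+1)%N ->
  (size (F * G)%R <= (m + n).+1)%N.
Proof. by move=> sF sG; have := size_polyMleq F G; size_lia. Qed.

Lemma vanishesMr n n' P e F G : vanishes n P e F -> (size G <= n'.+1)%N ->
  vanishes (n + n') P e (F * G).
Proof.
case: P => [a|] /= vF sG; first exact: dvdp_mulr.
have [->|F0] := eqVneq F 0; first by rewrite mul0r size_poly0.
by have := size_polyMleq F G; move: F0; rewrite -size_poly_gt0; size_lia.
Qed.

Lemma vanishesM n n' P e e' F G : vanishes n P e F -> vanishes n' P e' G ->
  vanishes (n + n') P (e + e') (F * G).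
Proof.
case: P => [a|] /= vF vG; first by rewrite exprD dvdp_mul.
have [->|F0] := eqVneq F 0; first by rewrite mul0r size_poly0.
have [->|G0] := eqVneq G 0; first by rewrite mulr0 size_poly0.
have := size_polyMleq F G; move: F0 G0; rewrite -!size_poly_gt0; size_lia.
Qed.

Lemma vanishesX n P e F m : vanishes n P e F ->
  vanishes (m * n) P (m * e) (F ^+ m).
Proof.
move=> vF; elim: m => [|m IHm]; last by rewrite exprS !mulSn vanishesM.
by case: P {vF} => [a|]; rewrite !mul0n expr0 /= ?dvd1p // size_poly1.
Qed.

Lemma vanishes_leq n n' P e F : (n <= n')%N ->
  vanishes n P e F -> vanishes n' P e F.
Proof. by case: P => //= le_nn' sF; size_lia. Qed.

Lemma vanishes_leq_ord n P e e' F : (e' <= e)%N ->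
  vanishes n P e F -> vanishes n P e' F.
Proof.
case: P => [a|] /= le_e; last by size_lia.
by apply: dvdp_trans; apply: dvdp_exp2l.
Qed.

Lemma form_ordM n n' P F G : F != 0 -> G != 0 ->
  (size F <= n.+1)%N -> (size G <= n'.+1)%N ->
  form_ord (n + n') P (F * G) = (form_ord n P F + form_ord n' P G)%N.
Proof.
case: P => [a|] F0 G0 sF sG /=; first by rewrite mupM.
rewrite size_mul //; move: F0 G0; rewrite -!size_poly_gt0; size_lia.
Qed.

Lemma size_form_exp n F m : (size F <= n.+1)%N -> (size (F ^+ m)%R <= (m * n).+1)%N.
Proof.
move=> sF; elim: m => [|m IHm]; first by rewrite expr0 size_poly1.
by rewrite exprS mulSn size_formM.
Qed.

Lemma form_ordX n P F m : F != 0 -> (size F <= n.+1)%N ->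
  form_ord (m * n) P (F ^+ m) = (m * form_ord n P F)%N.
Proof.
move=> F0 sF; elim: m => [|m IHm].
  by case: P => [a|]; rewrite !mul0n expr0 /= ?mupNroot ?root1 // size_poly1.
by rewrite exprS !mulSn form_ordM ?IHm ?expf_neq0 ?size_form_exp.
Qed.

Lemma fiber_formE Q : exists a b : k, forall N D, fiber_form Q N D = a *: N + b *: D.
Proof.
case: Q => [c|]; first by exists 1, (- c) => N D; rewrite scale1r scaleNr.
by exists 0, 1 => N D; rewrite scale0r scale1r add0r.
Qed.

Lemma size_fiber_form n Q N D : (size N <= n)%N -> (size D <= n)%N ->
  (size (fiber_form Q N D) <= n)%N.
Proof.
move=> sN sD; case: Q => //= c.
rewrite (leq_trans (size_polyD _ _)) // geq_max sN size_polyN /=.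
exact: leq_trans (size_scale_leq _ _) sD.
Qed.

Lemma fiber_formMl Q H N D : fiber_form Q (H * N) (H * D) = H * fiber_form Q N D.
Proof. by case: Q => //= c; rewrite mulrBr scalerAr. Qed.

Lemma wronskian_fiber_form Q F G : wronskian F G != 0 -> fiber_form Q F G != 0.
Proof.
apply: contra_neq; rewrite /wronskian; case: Q => [c|] /= => [/subr0_eq ->|->].
  by rewrite derivZ -!scalerAl mulrC subrr.
by rewrite deriv0 !mulr0 subrr.
Qed.

Lemma wronskianC F G : wronskian F G = - wronskian G F.
Proof. by rewrite /wronskian; ring. Qed.

(* The leading terms of the two products cancel. *)
Lemma size_wronskian d F G : (size F <= d.+1)%N -> (size G <= d.+1)%N ->
  (size (wronskian F G) <= (2 * d).-1)%N.
Proof.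
have lt_case (A B : {poly k}) : (size A <= d)%N -> (size B <= d.+1)%N ->
    (size (wronskian A B) <= (2 * d).-1)%N.
  move=> sA sB; rewrite (leq_trans (size_polyD _ _)) // size_polyN geq_max.
  have sdA : (size A^`() <= d.-1)%N.
    by have [->|/lt_size_deriv] := eqVneq A 0; rewrite ?deriv0 ?size_poly0; size_lia.
  have sdB : (size B^`() <= d)%N.
    by have [->|/lt_size_deriv] := eqVneq B 0; rewrite ?deriv0 ?size_poly0; size_lia.
  have [A0|A0] := eqVneq A 0.
    by rewrite A0 deriv0 !mul0r size_poly0.
  have [dA0|dA0] := eqVneq A^`() 0.
    rewrite dA0 mul0r size_poly0 /=.
    have := size_polyMleq A B^`(); move: A0; rewrite -size_poly_gt0; size_lia.
  have := size_polyMleq A B^`(); have := size_polyMleq A^`() B.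
  by move: A0 dA0; rewrite -!size_poly_gt0; size_lia.
move=> sF sG; have [G_d|G_d] := eqVneq G`_d 0.
  rewrite wronskianC size_polyN lt_case //; apply/leq_sizeP => j.
  by rewrite leq_eqVlt => /predU1P[<-//|ltdj]; rewrite nth_default ?(leq_trans sG).
(* Subtracting a multiple of [G] from [F] preserves the Wronskian, and this multiple cancels the
   coefficient of degree [d]. *)
have -> : wronskian F G = wronskian (F - (F`_d / G`_d) *: G) G.
  by rewrite /wronskian derivB derivZ -!mul_polyC; ring.
rewrite lt_case //; apply/leq_sizeP => j; rewrite coefB coefZ.
rewrite leq_eqVlt => /predU1P[<-//|ltdj]; first by rewrite divfK ?subrr.
by rewrite (nth_default _ (leq_trans sF ltdj)) (nth_default _ (leq_trans sG ltdj)) mulr0 subrr.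
Qed.

(** Differentiation costs at most one order of vanishing. At infinity this is a size count, in which
    only order 0 needs the cancellation in [size_wronskian]. *)
Lemma vanishes_wronskian d P e F G : (size F <= d.+1)%N -> (size G <= d.+1)%N ->
  vanishes d P e F -> vanishes (2 * d - 2) P e.-1 (wronskian F G).
Proof.
move=> sF sG; case: P => [a|] /=; case: e => [|e] vF //; rewrite ?dvd1p //.
- apply: dvdp_sub; last by rewrite dvdp_mulr // (dvdp_trans _ vF) // dvdp_exp2l.
  apply: dvdp_mulr; case/dvdpP: vF => A ->.
  rewrite derivM deriv_exp derivXsubC mul1r /= dvdp_add //.
    by rewrite dvdp_mull // dvdp_exp2l.
  by rewrite dvdp_mull // -mulr_natr dvdp_mulr.
- have := size_wronskian sF sG; case: d sF sG vF => [|d] sF sG vF; last by size_lia.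
  by rewrite leqn0 size_poly_eq0 => /eqP->; rewrite size_poly0.
rewrite subSS in vF.
have [->|F0] := eqVneq F 0; first by rewrite /wronskian deriv0 !mul0r subr0 size_poly0.
have sdF := lt_size_deriv F0.
have sdG : (size G^`() <= d)%N.
  by have [->|/lt_size_deriv] := eqVneq G 0; rewrite ?deriv0 ?size_poly0; size_lia.
have := size_polyMleq F G^`(); have := size_polyMleq F^`() G.
rewrite -size_poly_gt0 in F0; move=> s1 s2.
rewrite (leq_trans (size_polyD _ _)) // size_polyN geq_max; apply/andP; split.
  have [->|dF0] := eqVneq F^`() 0; first by rewrite mul0r size_poly0.
  by rewrite -size_poly_gt0 in dF0; size_lia.
have [->|dG0] := eqVneq G^`() 0; first by rewrite mulr0 size_poly0.
by rewrite -size_poly_gt0 in dG0; size_lia.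
Qed.

(** Replacing [F] by [F - c *: G] preserves the Wronskian and exchanging the two changes its sign,
    so [Q] can be moved to 0. *)
Lemma vanishes_wronskian_fiber d P e Q F G :
  (size F <= d.+1)%N -> (size G <= d.+1)%N ->
  vanishes d P e (fiber_form Q F G) ->
  vanishes (2 * d - 2) P e.-1 (wronskian F G).
Proof.
move=> sF sG; case: Q => [c|] /= vFG.
  have -> : wronskian F G = wronskian (F - c *: G) G.
    by rewrite /wronskian derivB derivZ -!mul_polyC; ring.
  by apply: vanishes_wronskian => //; apply: (@size_fiber_form _ (Some c)).
by rewrite wronskianC vanishesN // vanishes_wronskian.
Qed.

(** Replacing both numerators by their fibre forms leaves the determinant [N * D' - N' * D]
    unchanged, and then each product has a factor vanishing at [P]. *)
Lemma vanishes_cross d P e Q N D N' D' :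
  (size N <= d.+1)%N -> (size D <= d.+1)%N ->
  (size N' <= d.+1)%N -> (size D' <= d.+1)%N ->
  vanishes d P e (fiber_form Q N D) -> vanishes d P e (fiber_form Q N' D') ->
  vanishes (d + d) P e (N * D' - N' * D).
Proof.
move=> sN sD sN' sD'; case: Q => [c|] /= v v'.
  have -> : N * D' - N' * D = (N - c *: D) * D' - (N' - c *: D') * D.
    by rewrite -!mul_polyC; ring.
  by rewrite vanishesD ?vanishesN ?vanishesMr.
rewrite vanishesD ?vanishesN // mulrC vanishesMr //.
Qed.

End Forms.

(** Multiplicities at finite points are counted in a factorization into linear factors; infinity
    accounts for the missing degree. *)
Lemma sum_form_ord (k : closedFieldType) n (F : {poly k}) (s : seq (P1 k)) :
  F != 0 -> (size F <= n.+1)%N -> uniq s ->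
  (\sum_(P <- s) form_ord n P F <= n)%N.
Proof.
move=> F0 sF us.
have fin_le (r : seq k) : uniq r -> (\sum_(a <- r) mup a F <= (size F).-1)%N.
  move=> ur; have [t Ft] := closed_field_poly_normal F.
  have lF0 : lead_coef F != 0 by rewrite lead_coef_eq0.
  have -> : (size F).-1 = size t by rewrite Ft size_scale // size_prod_XsubC.
  have mupF a : mup a F = count_mem a t.
    rewrite {1}Ft -mul_polyC mupMr ?mu_prod_XsubC //.
    by rewrite rootC.
  rewrite (eq_bigr _ (fun a _ => mupF a)).
  apply: leq_trans (count_size [in r] t).
  elim: r ur => [|a r IHr] /=; first by rewrite big_nil.
  case/andP=> ar ur; rewrite big_cons.
  apply: leq_trans (leq_add (leqnn _) (IHr ur)) _.
  rewrite -[X in (_ <= X)%N]addn0 -count_predUI leq_eqVlt; apply/orP; left; apply/eqP.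
  rewrite (eq_count (a2 := [in a :: r])) => [|b]; last by rewrite /= inE.
  congr addn; rewrite -(count_pred0 t); apply: eq_count => b /=.
  by case: eqP => // ->; rewrite (negbTE ar).
have -> : (\sum_(P <- s) form_ord n P F)%N =
    (\sum_(a <- pmap id s) mup a F + (None \in s) * (n.+1 - size F))%N.
  elim: s us => [|P s IHs] /=; first by rewrite !big_nil.
  case/andP=> Ps us; rewrite big_cons IHs //.
  case: P Ps => [a|] /= Ps; first by rewrite big_cons addnA inE.
  by rewrite (negbTE Ps) mul0n addn0 mul1n addnC.
have upm : uniq (pmap id s) by apply: (@pmap_uniq _ _ id Some _ s us) => -[].
have := fin_le _ upm; move: F0; rewrite -size_poly_gt0.
by case: (None \in s); size_lia.
Qed.

(** The determinant of the two pairs has degree 2 d but more than 2 d zeros. *)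
Lemma cross_eq0 (k : closedFieldType) (I : finType) d (e : I -> nat)
    (P Q : I -> P1 k) (N D N' D' : {poly k}) :
  injective P -> (2 * d < \sum_i e i)%N ->
  (size N <= d.+1)%N -> (size D <= d.+1)%N ->
  (size N' <= d.+1)%N -> (size D' <= d.+1)%N ->
  (forall i, vanishes d (P i) (e i) (fiber_form (Q i) N D)) ->
  (forall i, vanishes d (P i) (e i) (fiber_form (Q i) N' D')) ->
  N * D' = N' * D.
Proof.
move=> injP lt_e sN sD sN' sD' v v'; apply/subr0_eq/eqP; apply: contraLR lt_e => W0.
have sW : (size (N * D' - N' * D)%R <= (d + d).+1)%N.
  by rewrite (leq_trans (size_polyD _ _)) // size_polyN geq_max !size_formM.
have us : uniq [seq P i | i : I] by rewrite map_inj_uniq ?enum_uniq.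
rewrite -leqNgt mul2n -addnn.
apply: leq_trans (sum_form_ord W0 sW us); rewrite big_image.
by apply: leq_sum => i _; rewrite -vanishesE // (@vanishes_cross _ _ _ _ (Q i)).
Qed.

(** The inequality in Riemann-Hurwitz, by counting zeros of the Wronskian; wild ramification may
    make it strict. An entry of [s] whose first point does not lie over the second contributes 0. *)
Lemma riemann_hurwitz (k : closedFieldType) d (s : seq (P1 k * P1 k))
    (N D : {poly k}) :
  wronskian N D != 0 -> (size N <= d.+1)%N -> (size D <= d.+1)%N ->
  uniq (unzip1 s) ->
  (\sum_(PQ <- s) (form_ord d PQ.1 (fiber_form PQ.2 N D)).-1 <= 2 * d - 2)%N.
Proof.
move=> W0 sN sD us.
have sW : (size (wronskian N D) <= (2 * d - 2).+1)%N.
  have := size_wronskian sN sD; size_lia.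
apply: leq_trans (sum_form_ord W0 sW us); rewrite big_map.
apply: leq_sum => -[P Q] _ /=; rewrite -vanishesE //.
apply: (@vanishes_wronskian_fiber _ _ _ _ Q) => //.
by rewrite vanishesE ?wronskian_fiber_form ?size_fiber_form.
Qed.

(** * Forms with prescribed zeros *)

Lemma linear_kernel_neq0 (k : fieldType) m n (f : 'rV[k]_m -> 'rV[k]_n) :
  linear f -> (n < m)%N -> exists2 v, v != 0 & f v = 0.
Proof.
move=> lin_f lt_nm.
pose fL : {linear 'rV[k]_m -> 'rV[k]_n} :=
  HB.pack f (GRing.isLinear.Build k 'rV[k]_m 'rV[k]_n _ f lin_f).
have /rowV0Pn[v /sub_kermxP vK v0] : kermx (lin1_mx fL) != 0.
  by rewrite kermx_eq0 /row_free ltn_eqF // (leq_ltn_trans (rank_leq_col _)).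
by exists v; rewrite // -[f v]/(fL v) -mul_rV_lin1.
Qed.

(** Encodes vanishing to order [e] as [e] linear conditions: a residue modulo a power of a linear
    polynomial or, at infinity, the top coefficients. *)
Definition jet (k : fieldType) n (P : P1 k) e (F : {poly k}) : 'rV[k]_e :=
  match P with
  | Some a => poly_rV (F %% ('X - a%:P) ^+ e)
  | None => \row_(j < e) F`_(n.+1 - e + j)
  end.

Lemma jet_linear (k : fieldType) n (P : P1 k) e : linear (jet n P e).
Proof.
case: P => [a|] c F G /=; first by rewrite modpD modpZl linearP.
by apply/rowP => j; rewrite !mxE coefD coefZ.
Qed.

Lemma jet_eq0 (k : fieldType) n (P : P1 k) e (F : {poly k}) :
  (size F <= n.+1)%N -> jet n P e F = 0 -> vanishes n P e F.
Proof.
case: P => [a|] /= sF.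
  move/(congr1 rVpoly); rewrite linear0 poly_rV_K => [/eqP //|].
  have := ltn_modp F (('X - a%:P) ^+ e).
  by rewrite size_exp_XsubC ltnS expf_neq0 ?polyXsubC_eq0.
move=> /rowP F0; apply/leq_sizeP => j lej.
have [ltnj|lejn] := ltnP n j; first by rewrite nth_default // (leq_trans sF).
have ltje : (j - (n.+1 - e) < e)%N by lia.
by have := F0 (Ordinal ltje); rewrite !mxE subnKC.
Qed.

Lemma exists_forms (k : fieldType) d (e : 'I_3 -> nat) (P Q : 'I_3 -> P1 k) :
  (\sum_i e i <= 2 * d + 1)%N ->
  exists N D : {poly k}, [/\ (size N <= d.+1)%N, (size D <= d.+1)%N,
    (N != 0) || (D != 0) &
    forall i, vanishes d (P i) (e i) (fiber_form (Q i) N D)].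
Proof.
rewrite !big_ord_recl big_ord0 addn0 => le_e.
pose F0 i (v : 'rV[k]_(d.+1 + d.+1)) :=
  fiber_form (Q i) (rVpoly (lsubmx v)) (rVpoly (rsubmx v)).
pose f i v : 'rV_(e i) := jet d (P i) (e i) (F0 i v).
have linF i : linear (F0 i).
  move=> c u v; rewrite /F0 linearD linearZ [rsubmx _]linearD linearZ /=.
  rewrite !linearD !linearZ /=; have [a [b ab]] := fiber_formE (Q i).
  by rewrite !ab -!mul_polyC; ring.
have linf i : linear (f i) by move=> c u v; rewrite /f linF jet_linear.
pose g v := row_mx (f ord0 v) (row_mx (f (lift ord0 ord0) v)
  (f (lift ord0 (lift ord0 ord0)) v)).
have ling : linear g.
  by move=> c u v; rewrite /g !linf !scale_row_mx !add_row_mx.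
have [|v v0] := linear_kernel_neq0 ling; first by lia.
rewrite /g => gv; exists (rVpoly (lsubmx v)), (rVpoly (rsubmx v)).
have fv i : f i v = 0.
  have := gv; rewrite -[RHS]row_mx0 => /eq_row_mx[f0].
  rewrite -[RHS]row_mx0 => /eq_row_mx[f1 f2].
  case: (unliftP ord0 i) => [j ->|-> //].
  case: (unliftP ord0 j) => [l ->|-> //].
  by rewrite [l]ord1.
split; rewrite ?size_poly //.
  apply: contraNT v0; rewrite negb_or !negbK => /andP[/eqP l0 /eqP r0].
  rewrite -[v]hsubmxK -[lsubmx v]rVpolyK -[rsubmx v]rVpolyK l0 r0.
  by rewrite !linear0 row_mx0.
by move=> i; apply: jet_eq0 (fv i); rewrite size_fiber_form ?size_poly.
Qed.

(** * Frobenius powers *)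

Lemma deriv_eq0_coef (R : idomainType) p (F : {poly R}) i :
  p \in [pchar R] -> F^`() = 0 -> ~~ (p %| i)%N -> F`_i = 0.
Proof.
move=> hp dF; case: i => [|i]; first by rewrite dvdn0.
rewrite (dvdn_pcharf hp) => i0; have /(congr1 (fun G : {poly R} => G`_i)) := dF.
rewrite coef_deriv coef0 -mulr_natr => /eqP.
by rewrite mulf_eq0 (negbTE i0) orbF => /eqP.
Qed.

(** A zero derivative leaves only exponents divisible by [p], and additivity of Frobenius collects
    the p-th roots of the coefficients. The ring is a domain because coefficients in k[x] occur
    later as well. *)
Lemma deriv_eq0_pth_power (R : idomainType) p (F : {poly R}) :
  p \in [pchar R] -> F^`() = 0 -> (forall i, exists r, F`_i = r ^+ p) ->
  exists G, F = G ^+ p.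
Proof.
move=> hp dF rootF; have p_gt0 := prime_gt0 (pcharf_prime hp).
have hpP : p \in [pchar {poly R}] by rewrite pchar_poly.
have [r rF] := fin_all_exists (fun j : 'I_(size F) => rootF (j * p)%N).
exists (\sum_(j < size F) r j *: 'X^j).
rewrite -(pFrobenius_autE hpP) rmorph_sum /=.
rewrite (eq_bigr (fun j : 'I_(size F) => F`_(j * p) *: 'X^(j * p))); last first.
  by move=> j _; rewrite pFrobenius_autE exprZn -rF exprM.
apply/polyP => i; rewrite coef_sum.
have [/dvdnP[j ->]|ndvd] := boolP (p %| i)%N; last first.
  rewrite (deriv_eq0_coef hp dF ndvd) big1 // => j _; rewrite coefZ coefXn.
  by case: eqP => [ij|]; rewrite ?mulr0 //; rewrite ij dvdn_mull in ndvd.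
have [ltj|lej] := ltnP j (size F).
  rewrite (bigD1 (Ordinal ltj)) //= big1 ?addr0 => [|l neq_l].
    by rewrite coefZ coefXn eqxx mulr1.
  rewrite coefZ coefXn eqn_pmul2r //; case: eqP => [jl|]; rewrite ?mulr0 //.
  by case/eqP: neq_l; apply: val_inj.
rewrite nth_default ?big1 // => [l _|]; last by rewrite (leq_trans lej) ?leq_pmulr.
rewrite coefZ coefXn eqn_pmul2r //; case: eqP => [jl|]; rewrite ?mulr0 //.
by have := ltn_ord l; rewrite -jl ltnNge lej.
Qed.

Lemma closed_field_root (k : closedFieldType) n (c : k) :
  (0 < n)%N -> exists x, c = x ^+ n.
Proof.
(* The list [[:: c]] makes every lower coefficient of the equation 0 except the constant one. *)
case: n => // n _; have [x xn] := solve_monicpoly (nth 0 [:: c]) (ltn0Sn n).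
exists x; rewrite xn big_ord_recl expr0 mulr1 big1 ?addr0 // => i _.
by rewrite nth_default ?mul0r.
Qed.

Lemma closed_deriv_eq0 (k : closedFieldType) p (F : {poly k}) :
  p \in [pchar k] -> F^`() = 0 -> exists G, F = G ^+ p.
Proof.
move=> hp dF; apply: (deriv_eq0_pth_power hp dF) => i.
exact/closed_field_root/prime_gt0/pcharf_prime/hp.
Qed.

(** With q = p^m and c = r^q, additivity of Frobenius turns N^q - c D^q into (N - r D)^q; infinity
    is its own twist. *)
Lemma fiber_form_Frobenius (k : closedFieldType) p m (Q : P1 k) :
  p \in [pchar k] -> exists Q', forall N D : {poly k},
    fiber_form Q (N ^+ (p ^ m)) (D ^+ (p ^ m)) = fiber_form Q' N D ^+ (p ^ m).
Proof.
move=> hp; have hq : [pchar {poly k}].-nat (p ^ m)%N.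
  by rewrite pnatX pnatE ?(pcharf_prime hp) ?pchar_poly ?hp.
case: Q => [c|]; last by exists None.
have [|r ->] := @closed_field_root k (p ^ m) c.
  by rewrite expn_gt0 prime_gt0 ?(pcharf_prime hp).
exists (Some r) => N D /=.
by rewrite exprDn_pchar // exprNn_pchar // exprZn.
Qed.

(** From F' G = F G' and coprimality, [F] divides F', which has smaller size than [F]. *)
Lemma coprime_wronskian_eq0 (k : fieldType) (F G : {poly k}) :
  coprimep F G -> wronskian F G = 0 -> F^`() = 0.
Proof.
move=> coFG /subr0_eq W0; apply: contraTeq coFG => dF0.
have F0 : F != 0 by apply: contraNneq dF0 => ->; rewrite deriv0.
apply/negP => coFG; have : F %| F^`() by rewrite -(Gauss_dvdpl _ coFG) W0 dvdp_mulIl.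
by move/(dvdp_leq dF0); rewrite leqNgt lt_size_deriv.
Qed.

Lemma size_expE (R : idomainType) (F : {poly R}) n : F != 0 ->
  size (F ^+ n) = ((size F).-1 * n).+1.
Proof. by move=> F0; rewrite -size_exp prednK // size_poly_gt0 expf_neq0. Qed.

Lemma size_exp_gt1 (k : fieldType) (F : {poly k}) n : (0 < n)%N ->
  (1 < size (F ^+ n)%R)%N = (1 < size F)%N.
Proof.
move=> n_gt0; have [->|F0] := eqVneq F 0; first by rewrite expr0n gtn_eqF.
rewrite size_expE // !ltnS; move: F0; rewrite -size_poly_gt0.
by case: (size F) => // s _; rewrite muln_gt0 n_gt0 andbT.
Qed.

(** As long as the Wronskian is zero both polynomials are p-th powers, and taking roots lowers the
    degree because the pair is not constant. *)
Lemma Frobenius_factorization (k : closedFieldType) p (N D : {poly k}) :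
  p \in [pchar k] -> coprimep N D -> (1 < maxn (size N) (size D))%N ->
  exists m (N1 D1 : {poly k}), [/\ N = N1 ^+ (p ^ m), D = D1 ^+ (p ^ m) &
    wronskian N1 D1 != 0].
Proof.
move=> hp; have p_gt1 := prime_gt1 (pcharf_prime hp); have p_gt0 := ltnW p_gt1.
have [n] := ubnP (maxn (size N) (size D)).
elim: n N D => // n IHn N D ltn coND gt1.
have [W0|W0] := eqVneq (wronskian N D) 0; last first.
  by exists 0%N, N, D; rewrite expn0 !expr1.
have [N1 DN] := closed_deriv_eq0 hp (coprime_wronskian_eq0 coND W0).
have [D1 DD] : exists D1, D = D1 ^+ p.
  apply: (closed_deriv_eq0 hp); apply: (@coprime_wronskian_eq0 _ D N).
    by rewrite coprimep_sym.
  by rewrite wronskianC W0 oppr0.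
move: ltn coND gt1; rewrite {}DN {}DD => ltn coND gt1.
have coND1 : coprimep N1 D1.
  by move: coND; rewrite coprimep_pexpl // coprimep_pexpr.
have gt1' : (1 < maxn (size N1) (size D1))%N.
  by move: gt1; rewrite !leq_max !size_exp_gt1.
have size_lt (F : {poly k}) :
    (size F <= size (F ^+ p)%R)%N /\ ((1 < size F) -> (size F < size (F ^+ p)%R))%N.
  have [->|F0] := eqVneq F 0; first by rewrite size_poly0.
  rewrite size_expE //; move: F0; rewrite -size_poly_gt0.
  case: (size F) => // s _; rewrite !ltnS leq_pmulr //; split=> // s_gt0.
  by rewrite ltn_Pmulr.
have [|//|//|m [N2 [D2 [-> -> W2]]]] := IHn N1 D1.
  by have [] := size_lt N1; have [] := size_lt D1; lia.
by exists m.+1, N2, D2; rewrite expnSr !exprM.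
Qed.

(** * Separability and the Wronskian *)

Lemma fraction_repr (R : idomainType) (u : {fraction R}) :
  exists nd : R * R, (nd.2 != 0) && (u == tofrac nd.1 / tofrac nd.2).
Proof.
elim/quotW: u => r; exists (\n_r, \d_r); rewrite denom_ratioP /=.
rewrite -[_ == _](can2_eq (mulfK _) (mulfVK _)) ?tofrac_eq0 ?denom_ratioP //.
unlock tofrac; rewrite !piE equivfE /FracField.mulf.
rewrite !numden_Ratio ?oner_eq0 ?mulf_neq0 ?denom_ratioP ?oner_eq0 //.
by rewrite !mulr1 mulrC.
Qed.

Lemma derivation_horner (L : comNzRingType) (D : L -> L) (q : {poly L}) u :
  D 0 = 0 -> {morph D : x y / x + y} ->
  (forall x y, D (x * y) = D x * y + x * D y) ->
  D q.[u] = (map_poly D q).[u] + q^`().[u] * D u.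
Proof.
move=> D0 DD DM; elim/poly_ind: q => [|q c IHq].
  by rewrite map_poly0 deriv0 !horner0 D0 mul0r addr0.
have -> : map_poly D (q * 'X + c%:P) = map_poly D q * 'X + (D c)%:P.
  apply/polyP => i; rewrite coef_map_id0 // !coefD !coefMX !coefC.
  case: i => [|i] /=; first by rewrite !add0r.
  by rewrite !addr0 coef_map_id0.
rewrite derivMXaddC !hornerE DD DM IHq; ring.
Qed.

(** The derivation d/dx of k(x), by the quotient rule on a chosen representative; [frac_deriv_div]
    shows that the choice does not matter. *)
Definition frac_deriv (k : fieldType) (u : {fraction {poly k}}) :
    {fraction {poly k}} :=
  let nd := xchoose (fraction_repr u) in
  tofrac (wronskian nd.1 nd.2) / tofrac nd.2 ^+ 2.

(** * The derivation d/dx on the field of rational functions *)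

Section FracDeriv.

Variable k : fieldType.
Local Notation K := {fraction {poly k}}.
Local Notation "x %:F" := (tofrac x).
Implicit Types (u v y : K) (F G : {poly k}) (q : {poly K}).

Lemma poly_fraction_repr u : exists F G, G != 0 /\ u = F%:F / G%:F.
Proof. by have [[F G] /= /andP[G0 /eqP->]] := fraction_repr u; exists F, G. Qed.

Lemma frac_deriv_div F G : G != 0 ->
  frac_deriv (F%:F / G%:F) = (wronskian F G)%:F / G%:F ^+ 2.
Proof.
move=> G0; rewrite /frac_deriv; have := xchooseP (fraction_repr (F%:F / G%:F)).
case: (xchoose _) => a b /= /andP[b0].
rewrite eqr_div ?tofrac_eq0 // -!tofracM tofrac_eq => /eqP Fb.
apply/eqP; rewrite eqr_div ?expf_neq0 ?tofrac_eq0 // -!tofracXn -!tofracM tofrac_eq.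
rewrite -subr_eq0; have := congr1 deriv Fb; rewrite !derivM => dFb.
(* The difference is a combination of F b - a G and its derivative, which are both zero. *)
have -> : wronskian a b * G ^+ 2 - wronskian F G * b ^+ 2 =
   (F * b - a * G) * (G * b^`() + G^`() * b) -
   G * b * (F^`() * b + F * b^`() - (a^`() * G + a * G^`())).
  by rewrite /wronskian; ring.
by rewrite Fb dFb !subrr mul0r mulr0 subr0.
Qed.

Lemma frac_deriv_tofrac F : frac_deriv F%:F = F^`()%:F.
Proof.
rewrite -[F%:F]divr1 -tofrac1 frac_deriv_div ?oner_eq0 //.
by rewrite tofrac1 expr1n divr1 /wronskian derivC mulr1 mulr0 subr0.
Qed.

Lemma frac_derivE u F G : G != 0 -> u = F%:F / G%:F ->
  frac_deriv u = (wronskian F G)%:F / G%:F ^+ 2.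
Proof. by move=> G0 ->; apply: frac_deriv_div. Qed.

Lemma frac_derivD u v : frac_deriv (u + v) = frac_deriv u + frac_deriv v.
Proof.
have [a [b [b0 uE]]] := poly_fraction_repr u.
have [c [d [d0 vE]]] := poly_fraction_repr v.
have fb0 : b%:F != 0 by rewrite tofrac_eq0.
have fd0 : d%:F != 0 by rewrite tofrac_eq0.
have uvE : u + v = (a * d + c * b)%:F / (b * d)%:F.
  by rewrite uE vE (addf_div _ _ fb0 fd0) tofracD !tofracM.
have bd0 : b * d != 0 by rewrite mulf_neq0.
rewrite (frac_derivE b0 uE) (frac_derivE d0 vE) (frac_derivE bd0 uvE).
have -> : wronskian (a * d + c * b) (b * d) = wronskian a b * d ^+ 2 + wronskian c d * b ^+ 2.
  by rewrite /wronskian !derivD !derivM; ring.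
rewrite (addf_div _ _ (expf_neq0 2 fb0) (expf_neq0 2 fd0)).
by rewrite tofracD (tofracM _ (d ^+ 2)) (tofracM _ (b ^+ 2)) !tofracXn tofracM exprMn.
Qed.

Lemma frac_derivM u v : frac_deriv (u * v) = frac_deriv u * v + u * frac_deriv v.
Proof.
have [a [b [b0 uE]]] := poly_fraction_repr u.
have [c [d [d0 vE]]] := poly_fraction_repr v.
have fb0 : b%:F != 0 by rewrite tofrac_eq0.
have fd0 : d%:F != 0 by rewrite tofrac_eq0.
have uvE : u * v = (a * c)%:F / (b * d)%:F by rewrite uE vE mulf_div !tofracM.
have bd0 : b * d != 0 by rewrite mulf_neq0.
rewrite (frac_derivE b0 uE) (frac_derivE d0 vE) (frac_derivE bd0 uvE).
have -> : wronskian (a * c) (b * d) = wronskian a b * (c * d) + a * b * wronskian c d.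
  by rewrite /wronskian !derivM; ring.
have quotient_rule (L : fieldType) (A B C D U V : L) : B != 0 -> D != 0 ->
    (U * (C * D) + A * B * V) / (B * D) ^+ 2 =
    U / B ^+ 2 * (C / D) + A / B * (V / D ^+ 2).
  by move=> B0 D0; field; rewrite B0 D0.
rewrite uE vE tofracD !tofracM.
exact: (quotient_rule K _ _ _ _ _ _ fb0 fd0).
Qed.

Lemma frac_deriv0 : frac_deriv (0 : K) = 0.
Proof. by rewrite -tofrac0 frac_deriv_tofrac deriv0. Qed.

Lemma frac_deriv_horner q u : frac_deriv q.[u] =
  (map_poly (@frac_deriv k) q).[u] + q^`().[u] * frac_deriv u.
Proof. exact: (derivation_horner q u frac_deriv0 frac_derivD frac_derivM). Qed.

Lemma frac_deriv_subst F y : frac_deriv (subst_poly F y) =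
  subst_poly F^`() y * frac_deriv y.
Proof.
rewrite /subst_poly frac_deriv_horner.
rewrite [X in X.[y]](_ : _ = 0) ?horner0 ?add0r; last first.
  apply/polyP => i; rewrite coef_map_id0 ?frac_deriv0 //.
  by rewrite coef_map_id0 ?tofrac0 // frac_deriv_tofrac derivC tofrac0 coef0.
congr (_.[y] * _).
have c0 : (0 : k)%:P%:F = 0 :> K by rewrite polyC0 tofrac0.
apply/polyP => i; rewrite coef_deriv !(coef_map_id0 _ _ c0).
by rewrite coef_deriv polyCMn tofracMn.
Qed.

End FracDeriv.

(** If the Wronskian is zero, d/dx kills k(f), hence the coefficients of a polynomial [q] over k(f)
    with root x. Differentiating q(x) = 0 leaves q'(x) = 0, so [q] is not separable. *)
Lemma separable_wronskian (k : fieldType) (f : ratmap k) :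
  separable_ratmap f -> wronskian (num f) (den f) != 0.
Proof.
move=> /(_ (tofrac 'X))[q [pull_q sep_q root_q]]; apply/eqP => W0.
have Df : frac_deriv (function_of f) = 0.
  (* For [den f = 0] the quotient is 0 by the convention on inverses, and its derivative is still
     0. *)
  rewrite /function_of; have [->|d0] := eqVneq (den f) 0.
    by rewrite tofrac0 invr0 mulr0 frac_deriv0.
  by rewrite frac_deriv_div // W0 tofrac0 mul0r.
have Dsubst A : frac_deriv (subst_poly A (function_of f)) = 0.
  by rewrite frac_deriv_subst Df mulr0.
have Dq : map_poly (@frac_deriv k) q = 0.
  apply/polyP => i; rewrite coef_map_id0 ?frac_deriv0 // coef0.
  have [A [B [B0 ->]]] := pull_q i.
  apply: (mulIf B0); rewrite mul0r.
  have := frac_derivM (subst_poly A (function_of f) / subst_poly B (function_of f))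
    (subst_poly B (function_of f)).
  by rewrite divfK // !Dsubst mulr0 addr0.
have := frac_deriv_horner q (tofrac 'X).
rewrite (rootP root_q) Dq horner0 add0r frac_deriv0 frac_deriv_tofrac derivX.
rewrite tofrac1 mulr1 => /esym/rootP root_dq.
move: sep_q; rewrite unlock => co_q.
by have := coprimep_root co_q root_q; rewrite (rootP root_dq) eqxx.
Qed.

(* Take Q of minimal degree.  If Q^`() = 0, the hypothesis on u forces the
   coefficients of Q to be, up to a common factor, constants for the
   derivation, that is p-th powers; then Q itself is a p-th power up to this
   factor, contradicting minimality. *)
Lemma separable_relation (k : closedFieldType) p (K : fieldType)
    (psi : {rmorphism {poly k} -> K}) (u : K) :
  p \in [pchar k] -> injective psi ->
  (forall Q : {poly {poly k}}, Q^`() = 0 -> root (map_poly psi Q) u ->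
     root (map_poly psi (map_poly deriv Q)) u) ->
  forall Q : {poly {poly k}}, Q != 0 -> root (map_poly psi Q) u ->
  exists Q' : {poly {poly k}},
    separable_poly (map_poly psi Q') /\ root (map_poly psi Q') u.
Proof.
move=> hp inj_psi root_deriv Q; have [n] := ubnP (size Q).
elim: n Q => // n IHn Q; rewrite ltnS => leQn Q0 rootQ.
have psi_eq0 A : (psi A == 0) = (A == 0).
  by rewrite -(rmorph0 psi) (inj_eq inj_psi).
have sQ : (1 < size Q)%N.
  rewrite ltnNge; apply: contraTN rootQ => /size1_polyC DQ.
  by rewrite DQ map_polyC rootC psi_eq0 -polyC_eq0 -DQ.
have [dQ0|dQ0] := eqVneq Q^`() 0.
  set L := lead_coef Q; have L0 : L != 0 by rewrite lead_coef_eq0.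
  (* Up to the factor L^2, this is Q / L with its coefficients differentiated. It has the root [u]
     and smaller size: either it is nonzero and induction applies, or the coefficients of Q / L are
     constants for d/dx. *)
  pose R := L *: map_poly deriv Q - L^`() *: Q.
  have coefR i : R`_i = L * (Q`_i)^`() - L^`() * Q`_i.
    by rewrite coefB !coefZ coef_map_id0 ?deriv0.
  have rootR : root (map_poly psi R) u.
    rewrite rmorphB /= !map_polyZ rootE !hornerE.
    by rewrite (rootP rootQ) (rootP (root_deriv _ dQ0 rootQ)) !mulr0 subr0.
  have ltR : (size R < size Q)%N.
    rewrite -[size Q]prednK ?ltnS ?(ltnW sQ) //; apply/leq_sizeP => j.
    rewrite leq_eqVlt coefR => /predU1P[<-|ltj].
      by rewrite -[Q`_ _]lead_coefE mulrC subrr.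
    by rewrite nth_default ?deriv0 ?mulr0 ?subrr //; size_lia.
  have [R0|R0] := eqVneq R 0; last exact: (IHn R (leq_trans ltR leQn) R0 rootR).
  have p_gt1 := prime_gt1 (pcharf_prime hp).
  (* As p - 1 = -1 in k, the derivative of L^(p-1) Q_i is L^(p-2) times the coefficient R_i. *)
  have dT i : (L ^+ p.-1 * Q`_i)^`() = 0.
    have := coefR i; rewrite R0 coef0 => Ri.
    have p1 : (p.-1%:R = -1 :> {poly k}).
      apply/eqP; rewrite -subr_eq0 opprK natr1 prednK ?(ltnW p_gt1) //.
      by rewrite (pcharf0 (_ : p \in [pchar {poly k}])) // pchar_poly.
    rewrite derivM deriv_exp -mulr_natr p1 -[in X in _ + X](prednK (_ : 0 < p.-1)%N).
      have -> : L^`() * L ^+ p.-1.-1 * -1 * Q`_i + L ^+ p.-1.-1.+1 * (Q`_i)^`() =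
        L ^+ p.-1.-1 * (L * (Q`_i)^`() - L^`() * Q`_i) by rewrite exprS; ring.
      by rewrite -Ri mulr0.
    by rewrite -ltnS prednK ?(ltnW p_gt1).
  have hpP : p \in [pchar {poly k}] by rewrite pchar_poly.
  have [|i|G DG] := @deriv_eq0_pth_power _ p (L ^+ p.-1 *: Q) hpP.
  - by rewrite derivZ dQ0 scaler0.
  - by rewrite coefZ; apply: closed_deriv_eq0.
  have T0 : L ^+ p.-1 *: Q != 0 
    by rewrite -size_poly_eq0 size_scale ?expf_neq0 // size_poly_eq0.
  have G0 : G != 0.
    by apply: contraNneq T0 => G0; rewrite DG G0 expr0n gtn_eqF // ltnW.
  have rootG : root (map_poly psi G) u.
    have : root (map_poly psi (L ^+ p.-1 *: Q)) u.
      by rewrite map_polyZ rootE hornerE (rootP rootQ) mulr0.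
    by rewrite DG rmorphXn rootE horner_exp expf_eq0 => /andP[_].
  apply: (IHn G _ G0 rootG); apply: leq_trans leQn.
  have <- : size (L ^+ p.-1 *: Q) = size Q by rewrite size_scale // expf_neq0.
  move: sQ; rewrite -(@size_scale _ (L ^+ p.-1) Q) ?expf_neq0 // DG size_expE //.
  move: G0; rewrite -size_poly_gt0; case: (size G) => // s _ /=.
  by rewrite !ltnS muln_gt0 => /andP[s_gt0 _]; rewrite ltn_Pmulr.
have rootM (A B : {poly {poly k}}) c : c != 0 -> c *: Q = A * B ->
    root (map_poly psi A) u || root (map_poly psi B) u.
  move=> c0 E; have : root (map_poly psi (c *: Q)) u.
    by rewrite map_polyZ rootE hornerE (rootP rootQ) mulr0.
  by rewrite E rmorphM rootM.
(* A Bezout relation for [Q] and its derivative holds up to nonzero scalars of k[x], which [psi]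
   maps to units of [K]. *)
have [co|nco] := boolP (coprimep Q Q^`()).
  exists Q; split=> //; rewrite unlock; apply/Bezout_coprimepP.
  have [[A B] /= /eqpP[[c1 c2] /= /andP[c10 c20] E]] := Bezout_coprimepP _ _ co.
  exists (map_poly psi A, map_poly psi B) => /=; apply/eqpP.
  exists (psi c1, psi c2); rewrite /= ?psi_eq0 ?c10 //.
  have := congr1 (map_poly psi) E.
  by rewrite !map_polyZ rmorphD !rmorphM rmorph1 /= deriv_map.
(* Otherwise [Q] is, up to a scalar, a product of two polynomials of smaller size, one of which has
   the root [u]. *)
have [[c h] /= c0 E] := Pdiv.Idomain.dvdpP _ _ (dvdp_gcdl Q Q^`()).
set g := gcdp Q Q^`() in E.
have g0 : g != 0 by rewrite gcdp_eq0 (negbTE Q0).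
have h0 : h != 0.
  apply: contraNneq Q0 => h0.
  by rewrite -size_poly_eq0 -(size_scale _ c0) E h0 mul0r size_poly0.
have ltg : (size g < size Q)%N.
  exact: leq_ltn_trans (leq_gcdpr _ dQ0) (lt_size_deriv Q0).
have lth : (size h < size Q)%N.
  have : size (c *: Q) = size (h * g) by rewrite E.
  rewrite size_scale // size_mul // => ->.
  move: nco; rewrite coprimep_def -/g; move: g0; rewrite -size_poly_gt0.
  move: h0; rewrite -size_poly_gt0; size_lia.
by have /orP[] := rootM _ _ _ c0 E; apply: IHn => //; apply: leq_trans leQn.
Qed.

(** Here [iota] embeds k[x] and [psi] sends x to y = N / D, while u = a / b. Multiplied by D^I b^J,
    the products y^i u^j become the polynomials [t i j] of bounded degree in x, and there are enough
    of them to be linearly dependent over k. *)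
Lemma algebraic_relation (k : closedFieldType) (K : fieldType)
    (iota psi : {rmorphism {poly k} -> K}) (u : K) (N D a b : {poly k}) :
  injective iota -> (forall c, psi c%:P = iota c%:P) ->
  D != 0 -> psi 'X * iota D = iota N ->
  b != 0 -> u * iota b = iota a ->
  exists2 Q : {poly {poly k}}, Q != 0 & root (map_poly psi Q) u.
Proof.
move=> inj_iota psiC D0 psiX b0 uE.
(* With these choices there are (I + 1) (J + 1) = n + d products in a space of dimension [n], and
   [d] is positive. *)
pose d := (size N + size D).+1; pose e := (size a + size b)%N.
pose I := (d * e)%N; pose J := d.
pose t i j := N ^+ i * D ^+ (I - i) * (a ^+ j * b ^+ (J - j)).
pose F (v : 'rV[k]_(I.+1 * J.+1)) : {poly k} :=
  \sum_(i < I.+1) \sum_(j < J.+1) vec_mx v i j *: t i j.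
pose n := (I * d + J * e).+1.
have linF : linear F.
  move=> c v w; rewrite /F scaler_sumr -big_split /=; apply: eq_bigr => i _.
  rewrite scaler_sumr -big_split /=; apply: eq_bigr => j _.
  by rewrite linearP !mxE scalerDl scalerA.
have sF v : (size (F v) <= n)%N.
  rewrite /n.
  rewrite (leq_trans (size_sum _ _ _)) //; apply/bigmax_leqP => i _.
  rewrite (leq_trans (size_sum _ _ _)) //; apply/bigmax_leqP => j _.
  rewrite (leq_trans (size_scale_leq _ _)) //.
  have -> : (I * d = i * d + (I - i) * d)%N.
    by rewrite -mulnDl subnKC // -ltnS.
  have -> : (J * e = j * e + (J - j) * e)%N.
    by rewrite -mulnDl subnKC // -ltnS.
  by do ![apply: size_formM]; apply: size_form_exp; rewrite /d /e; size_lia.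
pose G v : 'rV_n := poly_rV (F v).
have linG : linear G by move=> c v w; rewrite /G linF linearP.
have [|v v0] := linear_kernel_neq0 linG; first by rewrite /n /I /J /d; nia.
rewrite /G => /(congr1 rVpoly); rewrite linear0 poly_rV_K // => Fv.
pose Q : {poly {poly k}} := \poly_(j < J.+1) \poly_(i < I.+1) vec_mx v (inord i) (inord j).
exists Q.
  apply: contraNneq v0 => Q0; rewrite -[v]vec_mxK; apply/eqP.
  rewrite (_ : vec_mx v = 0) ?linear0 //; apply/matrixP => i j.
  have /(congr1 (fun R : {poly {poly k}} => R`_j`_i)) := Q0.
  by rewrite coef_poly ltn_ord coef_poly ltn_ord !inord_val !coef0 => ->; rewrite mxE.
have iotaD0 : iota D != 0 by rewrite -(rmorph0 iota) (inj_eq inj_iota).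
have iotab0 : iota b != 0 by rewrite -(rmorph0 iota) (inj_eq inj_iota).
have cD0 : iota D ^+ I * iota b ^+ J != 0 by rewrite mulf_neq0 ?expf_neq0.
rewrite /root -(mulrI_eq0 _ (mulfI cD0)).
have <- : iota (F v) = 0 by rewrite Fv rmorph0.
apply/eqP; rewrite /F /Q poly_def rmorph_sum /= horner_sum mulr_sumr.
rewrite rmorph_sum /= (eq_bigr (fun i : 'I_I.+1 => \sum_(j < J.+1)
  iota (vec_mx v i j *: t i j))) => [|i _]; last by rewrite rmorph_sum.
rewrite exchange_big /=; apply: eq_bigr => j _.
rewrite map_polyZ map_polyXn hornerZ hornerXn poly_def rmorph_sum mulr_suml mulr_sumr.
apply: eq_bigr => i _; rewrite !inord_val -!mul_polyC !rmorphM !rmorphXn /= psiC.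
rewrite -psiX -uE.
rewrite -{1}(subnKC (_ : i <= I)%N) -1?ltnS // -{1}(subnKC (_ : j <= J)%N) -1?ltnS //.
by rewrite !exprD !exprMn; ring.
Qed.

Lemma subst_poly_is_morphism (k : fieldType) (y : {fraction {poly k}}) :
  exists2 psi : {rmorphism {poly k} -> {fraction {poly k}}},
    (forall A, psi A = subst_poly A y) &
    (forall c, psi c%:P = tofrac c%:P) /\ psi 'X = y.
Proof.
pose constF : {rmorphism k -> {fraction {poly k}}} :=
  (@tofrac _ : {rmorphism {poly k} -> {fraction {poly k}}}) \o (polyC : {rmorphism k -> {poly k}}).
exists (horner_morph (fun a => mulrC y (constF a))) => //; split.
  by move=> c; apply: horner_morphC.
exact: horner_morphX.
Qed.

(** A nonzero polynomial is a nonzero scalar times linear factors, none of which maps to 0. *)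
Lemma closed_rmorph_inj (k : closedFieldType) (K : fieldType)
    (psi : {rmorphism {poly k} -> K}) :
  (forall c, psi 'X != psi c%:P) -> injective psi.
Proof.
move=> psiX; suff ker0 A : psi A = 0 -> A = 0.
  by move=> A B AB; apply/subr0_eq/ker0; rewrite rmorphB AB subrr.
move=> psiA; apply/eqP/negPn/negP => A0.
have psiC c : c != 0 -> psi c%:P != 0.
  move=> c0; apply: contra_neq (oner_neq0 K) => psic.
  by rewrite -(rmorph1 psi) -polyC1 -(mulfV c0) polyCM rmorphM psic mul0r.
have [r Ar] := closed_field_poly_normal A.
move: psiA; rewrite Ar -mul_polyC rmorphM rmorph_prod /= => /eqP.
rewrite mulf_eq0 (negbTE (psiC _ _)) ?lead_coef_eq0 //= prodf_seq_eq0.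
by case/hasP=> c _; rewrite rmorphB subr_eq0 (negbTE (psiX c)).
Qed.

(** Since y = f is not constant, x -> y embeds k[x]. If R(y, u) = 0 and R has zero derivative in its
    second variable, applying d/dx gives y' R_1(y, u) = 0, where R_1 is the derivative in the first
    variable. As y' is nonzero, this is the hypothesis of [separable_relation]. *)
Lemma wronskian_separable (k : closedFieldType) p (f : ratmap k) :
  p \in [pchar k] -> wronskian (num f) (den f) != 0 -> separable_ratmap f.
Proof.
move=> hp W0 u; have d0 : den f != 0.
  by apply: contraNneq W0 => d0; rewrite /wronskian d0 deriv0 !mulr0 subrr.
have fd0 : tofrac (den f) != 0 by rewrite tofrac_eq0.
set y := function_of f; have yE : y * tofrac (den f) = tofrac (num f).
  by rewrite /y /function_of divfK.
have Dy0 : frac_deriv y != 0.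
  have -> := frac_derivE d0 (erefl y).
  apply: mulf_neq0; first by rewrite tofrac_eq0.
  by rewrite invr_eq0 expf_neq0.
have [psi psiE [psiC psiX]] := subst_poly_is_morphism y.
have inj_psi : injective psi.
  apply: closed_rmorph_inj => c; rewrite psiX psiC; apply: contraNneq W0 => yc.
  have : num f = c *: den f.
    by apply/eqP; rewrite -mul_polyC -tofrac_eq -yE yc tofracM.
  by rewrite /wronskian => ->; rewrite derivZ -!scalerAl mulrC subrr.
have inj_tofrac : injective (@tofrac _ : {rmorphism {poly k} -> {fraction {poly k}}}).
  by move=> A B /eqP; rewrite tofrac_eq => /eqP.
have [a [b [b0 uE]]] := poly_fraction_repr u.
have ubE : u * tofrac b = tofrac a.
  have fb0 : tofrac b != 0 by rewrite tofrac_eq0.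
  by rewrite uE (divfK fb0).
have psiXE : psi 'X * tofrac (den f) = tofrac (num f) by rewrite psiX.
have [Q Q0 rootQ] := algebraic_relation inj_tofrac psiC d0 psiXE b0 ubE.
have [|q [sep_q root_q]] := separable_relation hp inj_psi _ Q0 rootQ; last first.
  exists (map_poly psi q); split=> // i; exists q`_i, 1.
  have <- : psi 1 = subst_poly 1 y by apply: psiE.
  by rewrite -psiE coef_map rmorph1 oner_neq0 divr1.
move=> R dR rootR; have := frac_deriv_horner (map_poly psi R) u.
rewrite (rootP rootR) frac_deriv0 deriv_map dR rmorph0 horner0 mul0r addr0.
have -> : map_poly (@frac_deriv k) (map_poly psi R) =
    frac_deriv y *: map_poly psi (map_poly deriv R).
  apply/polyP => i; rewrite coefZ coef_map_id0 ?frac_deriv0 //.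
  have psiRi := coef_map psi R i; have psidRi := coef_map psi (map_poly deriv R) i.
  rewrite psiRi psidRi (coef_map_id0 _ _ (deriv0 _)) /= psiE psiE.
  by rewrite frac_deriv_subst mulrC.
by rewrite hornerZ => /esym/eqP; rewrite mulf_eq0 (negbTE Dy0).
Qed.

(** * Numerical admissibility *)

Lemma deriv_pth_power (R : comNzRingType) p m (F : {poly R}) :
  p \in [pchar R] -> (0 < m)%N -> (F ^+ (p ^ m))^`() = 0.
Proof.
case: m => // m hp _; rewrite deriv_exp -mulr_natr expnS natrM.
by rewrite (pcharf0 (_ : p \in [pchar {poly R}])) ?pchar_poly // mul0r mulr0.
Qed.

(** N / D is the q-th power of F / G, so its derivative is zero; [G = 0] forces [D = 0]. *)
Lemma inseparable_ratio (k : fieldType) p m (N D F G : {poly k}) :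
  p \in [pchar k] -> (0 < m)%N -> (F != 0) || (G != 0) ->
  N * G ^+ (p ^ m) = F ^+ (p ^ m) * D -> wronskian N D = 0.
Proof.
move=> hp m_gt0; set q := (p ^ m)%N => FG0 E.
have q_gt0 : (0 < q)%N by rewrite expn_gt0 prime_gt0 ?(pcharf_prime hp).
have [G0|G0] := eqVneq G 0.
  move: FG0; rewrite G0 eqxx orbF => F0; move/eqP: E.
  rewrite G0 expr0n gtn_eqF // mulr0 eq_sym mulf_eq0 expf_eq0 (negbTE F0) andbF /=.
  by move/eqP->; rewrite /wronskian deriv0 !mulr0 subrr.
have := congr1 deriv E; rewrite !derivM !deriv_pth_power // mulr0 addr0 mul0r add0r => dE.
apply: (mulIf (expf_neq0 q G0)); rewrite mul0r.
have -> : wronskian N D * G ^+ q = D * (N^`() * G ^+ q) - D^`() * (N * G ^+ q).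
  by rewrite /wronskian; ring.
by rewrite dE E; ring.
Qed.

(** The form of degree 1 with zero [P]; the one vanishing at infinity dehomogenizes to 1. *)
Definition linear_form (k : fieldType) (P : P1 k) : {poly k} :=
  if P is Some a then 'X - a%:P else 1.

Lemma linear_form_neq0 (k : fieldType) (P : P1 k) : linear_form P != 0.
Proof. by case: P => [a|] /=; rewrite ?polyXsubC_eq0 ?oner_neq0. Qed.

Lemma vanishes_linear_form (k : fieldType) (P : P1 k) : vanishes 1 P 1 (linear_form P).
Proof. by case: P => [a|] /=; rewrite ?expr1 ?dvdpp ?size_poly1. Qed.

Lemma size_linear_form (k : fieldType) (P : P1 k) : (size (linear_form P) <= 2)%N.
Proof. by case: P => [a|] /=; rewrite ?size_XsubC ?size_poly1. Qed.

Lemma form_with_zeros (k : fieldType) (I : finType) (P : I -> P1 k) (a : I -> nat) :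
  exists H : {poly k}, [/\ H != 0, (size H <= (\sum_i a i).+1)%N &
    forall i, vanishes (\sum_i a i) (P i) (a i) H].
Proof.
have sL i : (size (linear_form (P i) ^+ a i)%R <= (a i).+1)%N.
  by rewrite -[X in (_ <= X.+1)%N]muln1 size_form_exp ?size_linear_form.
have sP (p : pred I) : (size (\prod_(i | p i) linear_form (P i) ^+ a i)%R <=
    (\sum_(i | p i) a i).+1)%N.
  elim/big_rec2: _ => [|i m H _ sH]; first by rewrite size_poly1.
  by rewrite size_formM.
exists (\prod_i linear_form (P i) ^+ a i); split.
- by apply/prodf_neq0 => i _; rewrite expf_neq0 ?linear_form_neq0.
- exact: sP.
move=> i; have -> : (\sum_j a j = a i + \sum_(j | j != i) a j)%N by rewrite (bigD1 i).
have -> : \prod_j linear_form (P j) ^+ a j =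
    linear_form (P i) ^+ a i * \prod_(j | j != i) linear_form (P j) ^+ a j.
  by rewrite (bigD1 i).
apply: vanishesMr; last exact: sP.
by have := vanishesX (a i) (vanishes_linear_form (P i)); rewrite !muln1.
Qed.

Lemma sum_in_setC (I : finType) (S : {set I}) (F G : I -> nat) :
  (\sum_(i in S) F i + \sum_(i in ~: S) G i)%N =
  (\sum_i (if i \in S then F i else G i))%N.
Proof.
rewrite [RHS](bigID (mem S)) /=; congr (_ + _)%N.
  by apply: eq_bigr => i ->.
by apply: eq_big => i; rewrite inE // => /negbTE->.
Qed.

Lemma forms_admissible (k : closedFieldType) p d (e : 'I_3 -> nat)
    (P Q : 'I_3 -> P1 k) (N D : {poly k}) :
  p \in [pchar k] -> (\sum_i e i = 2 * d + 1)%N -> injective P ->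
  (size N <= d.+1)%N -> (size D <= d.+1)%N -> wronskian N D != 0 ->
  (forall i, vanishes d (P i) (e i) (fiber_form (Q i) N D)) ->
  numerically_admissible p d e.
Proof.
move=> hp hde injP sN sD W0 vND m S m_gt0 _ _ oddS.
rewrite leqNgt; apply/negP; set q := (p ^ m)%N; rewrite sum_in_setC.
pose r i := if i \in S then rem_down p m (e i) else rem_up p m (e i).
rewrite -/(r _) => ltR.
have q_gt0 : (0 < q)%N by rewrite expn_gt0 prime_gt0 ?(pcharf_prime hp).
(* [eps] gives the orders prescribed for [F] and [G]; [a] counts the zeros that their q-th powers
   fail to supply at the points of [S]. *)
pose eps i := if i \in S then bar_down p m (e i) else bar_up p m (e i).
pose a i := if i \in S then rem_down p m (e i) else 0%N.
have [delta sum_eps] : exists delta, (\sum_i eps i = 2 * delta + 1)%N.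
  exists (\sum_i eps i)./2; move: oddS; rewrite sum_in_setC -/(eps _) => odd_eps.
  by rewrite -{1}[(\sum_i eps i)%N]odd_double_half odd_eps; lia.
have down_le i : (q * bar_down p m (e i) <= e i)%N.
  by rewrite /bar_down mulnC leq_divM.
have up_ge i : (e i <= q * bar_up p m (e i))%N.
  rewrite /bar_up -/q; have := divn_eq (e i + q.-1) q.
  by have := ltn_pmod (e i + q.-1) q_gt0; lia.
(* From 2 sum a + q sum eps = sum e + sum r and sum r < q follows 2 (sum a + q delta) < 2 d + 1: the
   inseparable pair fits into degree [d]. *)
have sum_le : (\sum_i a i + q * delta <= d)%N.
  have sumE : (2 * \sum_i a i + q * \sum_i eps i = \sum_i e i + \sum_i r i)%N.
    rewrite !big_distrr -!big_split /=; apply: eq_bigr => i _.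
    rewrite /a /eps /r /rem_down /rem_up -/q.
    by case: (i \in S); have := down_le i; have := up_ge i; lia.
  by move: sumE ltR; rewrite sum_eps hde; move: (\sum_i a i)%N (\sum_i r i)%N; lia.
have [Q' Q'E] : exists Q', forall i (F G : {poly k}),
    fiber_form (Q i) (F ^+ q) (G ^+ q) = fiber_form (Q' i) F G ^+ q.
  have [Q' Q'E] := fin_all_exists (fun i => fiber_form_Frobenius m (Q i) hp).
  by exists Q'.
have [|F [G [sF sG FG0 vFG]]] := @exists_forms k delta eps P Q'.
  by rewrite sum_eps.
have [H [H0 sH vH]] := form_with_zeros P a.
have E : N * (H * G ^+ q) = (H * F ^+ q) * D.
  apply: (@cross_eq0 k _ d e P Q) => //; first by rewrite hde addn1.
  - by rewrite (leq_trans (size_formM sH (size_form_exp q sF))).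
  - by rewrite (leq_trans (size_formM sH (size_form_exp q sG))).
  move=> i; rewrite fiber_formMl Q'E.
  apply: (vanishes_leq sum_le); apply: (@vanishes_leq_ord _ _ _ (a i + q * eps i)).
    rewrite /a /eps /rem_down -/q.
    by case: (i \in S); have := down_le i; have := up_ge i; lia.
  exact/vanishesM/vanishesX.
have E' : N * G ^+ q = F ^+ q * D.
  by apply: (mulfI H0); rewrite mulrCA E mulrA.
by case/eqP: W0; apply: (inseparable_ratio hp m_gt0 FG0 E').
Qed.

Lemma fiber_form_common_zero (k : fieldType) (Q Q' : P1 k) (F G : {poly k}) :
  (F != 0) || (G != 0) -> fiber_form Q F G = 0 -> fiber_form Q' F G = 0 -> Q = Q'.
Proof.
move=> FG0; case: Q Q' => [c|] [c'|] //=.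
- move=> /subr0_eq E /subr0_eq; rewrite E => /eqP; rewrite -subr_eq0 -scalerBl.
  rewrite -mul_polyC mulf_eq0 polyC_eq0 subr_eq0 => /orP[/eqP-> // | /eqP G0].
  by move: FG0; rewrite E G0 scaler0 eqxx.
- by move=> + G0; rewrite G0 scaler0 subr0 => F0; rewrite F0 G0 eqxx in FG0.
- by move=> G0; rewrite G0 scaler0 subr0 => F0; rewrite F0 G0 eqxx in FG0.
Qed.

Lemma sum_form_ord_image (k : closedFieldType) n (F : {poly k}) (I : finType)
    (P : I -> P1 k) (A : pred I) :
  F != 0 -> (size F <= n.+1)%N -> injective P ->
  (\sum_(i | A i) form_ord n (P i) F <= n)%N.
Proof.
move=> F0 sF injP; have us : uniq [seq P i | i in A] by rewrite map_inj_uniq ?enum_uniq.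
by have := sum_form_ord F0 sF us; rewrite big_image.
Qed.

(** For constant [F] and [G] at most one fibre form is zero, say over Q_l. At the other two points
    [H] carries all the zeros, at least 2 d + 1 - e_l > d of them, against its degree. *)
Lemma nonconstant_ratio (k : closedFieldType) d (e : 'I_3 -> nat)
    (P Q : 'I_3 -> P1 k) (H F G : {poly k}) :
  (\sum_i e i = 2 * d + 1)%N -> (forall i, e i <= d)%N ->
  injective P -> injective Q -> H != 0 -> (size H <= d.+1)%N ->
  (F != 0) || (G != 0) ->
  (forall i, vanishes d (P i) (e i) (fiber_form (Q i) (H * F) (H * G))) ->
  (1 < maxn (size F) (size G))%N.
Proof.
move=> hde hed injP injQ H0 sH FG0 vH; rewrite ltnNge geq_max; apply/negP => /andP[sF sG].
pose z i := fiber_form (Q i) F G == 0.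
have [l zl] : exists l, forall i, i != l -> ~~ z i.
  have [l zl|nz] := pickP z; last by exists ord0 => i _; rewrite nz.
  exists l => i; apply: contra_neqN => /eqP zi.
  exact/injQ/(fiber_form_common_zero FG0 zi (eqP zl)).
have vHi i : i != l -> (e i <= form_ord d (P i) H)%N.
  move=> /zl zi; rewrite -vanishesE //.
  have := vH i; rewrite fiber_formMl; move: zi; rewrite /z.
  have /size1_polyC-> := size_fiber_form (Q i) sF sG.
  set c := _`_0; rewrite polyC_eq0 => c0; rewrite mulrC mul_polyC.
  by move/(vanishesZ c^-1); rewrite scalerA mulVf // scale1r.
have := sum_form_ord_image (fun i => i != l) H0 sH injP; rewrite leqNgt => /negP[].
apply: leq_trans (leq_sum _ vHi).
move: hde; rewrite (bigD1 l) //=; have := hed l.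
by move: (\sum_(i < 3 | i != l) e i)%N => s; lia.
Qed.

(** After removal of the gcd, F / G is the separable part, of degree [delta], with order [eps i] at
    P_i over the untwisted point [Q' i]. The two truncated differences in the last bound add up to
    |q eps_i - e_i|. *)
Lemma forms_analysis (k : closedFieldType) p d (e : 'I_3 -> nat)
    (P Q : 'I_3 -> P1 k) (N D : {poly k}) :
  p \in [pchar k] -> (\sum_i e i = 2 * d + 1)%N -> (forall i, e i <= d)%N ->
  injective P -> injective Q ->
  (size N <= d.+1)%N -> (size D <= d.+1)%N -> (N != 0) || (D != 0) ->
  (forall i, vanishes d (P i) (e i) (fiber_form (Q i) N D)) ->
  exists m (F G : {poly k}) (Q' : 'I_3 -> P1 k), let q := (p ^ m)%N in
  let delta := (maxn (size F) (size G)).-1 in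
  let eps i := form_ord delta (P i) (fiber_form (Q' i) F G) in
  [/\ coprimep F G /\ wronskian F G != 0,
      forall i (A B : {poly k}), fiber_form (Q i) (A ^+ q) (B ^+ q) =
                                 fiber_form (Q' i) A B ^+ q,
      (0 < delta)%N /\ (q * delta <= d)%N,
      (\sum_i eps i = 2 * delta + 1)%N /\ (forall i, 0 < eps i)%N &
      (\sum_i ((q * eps i - e i) + (e i - q * eps i)) < q)%N].
Proof.
move=> hp hde hed injP injQ sN sD ND0 vND.
pose H := gcdp N D.
have H0 : H != 0 by rewrite gcdp_eq0 negb_and.
have [N1 NE] : exists N1, N = H * N1.
  by exists (N %/ H); rewrite mulrC divpK ?dvdp_gcdl.
have [D1 DE] : exists D1, D = H * D1.
  by exists (D %/ H); rewrite mulrC divpK ?dvdp_gcdr.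
have coND1 : coprimep N1 D1.
  have := coprimep_div_gcd ND0; rewrite -/H {1}NE {1}DE.
  by rewrite ![H * _]mulrC !mulpK.
have ND10 : (N1 != 0) || (D1 != 0).
  by move: ND0; rewrite NE DE !mulf_eq0 (negbTE H0).
have sH : (size H <= d.+1)%N.
  have [N0|N0] := eqVneq N 0; last exact: leq_trans (leq_gcdpl _ N0) sN.
  by move: ND0; rewrite N0 eqxx /= => D0; apply: leq_trans (leq_gcdpr _ D0) sD.
have gt1 : (1 < maxn (size N1) (size D1))%N.
  by apply: (nonconstant_ratio hde hed injP injQ H0 sH ND10) => i; rewrite -NE -DE.
have [m [F [G [N1E D1E W0]]]] := Frobenius_factorization hp coND1 gt1.
have q_gt0 : (0 < p ^ m)%N by rewrite expn_gt0 prime_gt0 ?(pcharf_prime hp).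
have [Q' Q'E] : exists Q', forall i (A B : {poly k}),
    fiber_form (Q i) (A ^+ (p ^ m)) (B ^+ (p ^ m)) = fiber_form (Q' i) A B ^+ (p ^ m).
  have [Q' Q'E] := fin_all_exists (fun i => fiber_form_Frobenius m (Q i) hp).
  by exists Q'.
exists m, F, G, Q'; pose q := (p ^ m)%N; rewrite -/q in q_gt0 Q'E N1E D1E.
pose delta := (maxn (size F) (size G)).-1.
pose eps i := form_ord delta (P i) (fiber_form (Q' i) F G).
have sF : (size F <= delta.+1)%N.
  by rewrite (leq_trans (leq_maxl (size F) (size G))) ?leqSpred.
have sG : (size G <= delta.+1)%N.
  by rewrite (leq_trans (leq_maxr (size F) (size G))) ?leqSpred.
have delta_gt0 : (0 < delta)%N.
  have := size_wronskian sF sG; rewrite lt0n; apply: contraTneq => ->.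
  by rewrite -ltnNge size_poly_gt0.
have coFG : coprimep F G.
  by move: coND1; rewrite N1E D1E coprimep_pexpl // coprimep_pexpr.
(* One of [F] and [G] has size exactly [delta.+1], which leaves degree at most d - q delta for
   [H]. *)
have size_top (A B : {poly k}) : (size B <= d.+1)%N -> B = H * A ^+ q ->
    size A = delta.+1 -> (size H + q * delta <= d.+1)%N.
  move=> sB BE sA; have A0 : A != 0 by rewrite -size_poly_gt0 sA.
  by move: sB; rewrite BE size_mul ?expf_neq0 // size_expE // sA addnS /= mulnC.
have sHd : (size H + q * delta <= d.+1)%N.
  have : (size F == delta.+1) || (size G == delta.+1).
    have <- : maxn (size F) (size G) = delta.+1.
      by rewrite prednK //; move: delta_gt0; rewrite /delta; case: (maxn _ _).
    by rewrite /maxn; case: ifP => _; rewrite eqxx ?orbT.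
  case/orP=> /eqP sA.
    by apply: (size_top F N) => //; rewrite NE N1E.
  by apply: (size_top G D) => //; rewrite DE D1E.
have H_gt0 : (0 < size H)%N by rewrite size_poly_gt0.
have le_qd : (q * delta <= d)%N.
  by rewrite -ltnS (leq_trans _ sHd) // -[X in (X <= _)%N]add1n leq_add2r.
have sH' : (size H <= (d - q * delta).+1)%N.
  by rewrite -subSn // -(leq_add2r (q * delta)) subnK // leqW.
pose a i := form_ord (d - q * delta) (P i) H.
have sum_a : (\sum_i a i <= d - q * delta)%N.
  exact: (sum_form_ord_image predT H0 sH' injP).
have e_le i : (e i <= a i + q * eps i)%N.
  have := vND i; rewrite NE DE N1E D1E fiber_formMl Q'E.
  have ff0 : fiber_form (Q' i) F G != 0 by rewrite wronskian_fiber_form.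
  have sff : (size (fiber_form (Q' i) F G) <= delta.+1)%N by rewrite size_fiber_form.
  rewrite -{1}(subnK le_qd) vanishesE ?mulf_neq0 ?expf_neq0 ?size_formM ?size_form_exp //.
  by rewrite form_ordM ?expf_neq0 ?size_form_exp // form_ordX.
have RH : (\sum_i (eps i).-1 <= 2 * delta - 2)%N.
  pose s := [seq (P i, Q' i) | i <- enum 'I_3].
  have us : uniq (unzip1 s).
    by rewrite /unzip1 -map_comp map_inj_uniq ?enum_uniq.
  by have := riemann_hurwitz W0 sF sG us; rewrite big_map big_enum.
have [sum_eps eps_gt0 ltq] : [/\ (\sum_i eps i = 2 * delta + 1)%N,
   (forall i, 0 < eps i)%N & (\sum_i ((q * eps i - e i) + (e i - q * eps i)) < q)%N].
  have sum_b : (\sum_i ((q * eps i - e i) + (e i - q * eps i)) + \sum_i e i <=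
      2 * \sum_i a i + q * \sum_i eps i)%N.
    rewrite !big_distrr -!big_split /=; apply: leq_sum => i _.
    by move: (e_le i); move: (e i) (a i) (q * eps i)%N; clear; lia.
  have le_eps : (\sum_i eps i <= \sum_i (eps i).-1 + 3)%N.
    apply: (@leq_trans (\sum_i ((eps i).-1 + 1))).
      by apply: leq_sum => i _; rewrite addn1 leqSpred.
    by rewrite big_split sum1_card card_ord.
  (* Riemann-Hurwitz bounds the sum by 2 delta + 1; a sum of at most 2 delta would give sum e_i <= 2
     d by [sum_b]. *)
  have sum_epsE : (\sum_i eps i = 2 * delta + 1)%N.
    apply/eqP; rewrite eqn_leq; apply/andP; split.
      by move: (\sum_i eps i)%N RH le_eps delta_gt0 => s; clear; lia.
    rewrite addn1 ltnNge; apply/negP => le2.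
    have : (q * \sum_i eps i <= q * (2 * delta))%N by rewrite leq_mul2l le2 orbT.
    move: sum_b sum_a le_qd; rewrite hde; move: (\sum_i a i)%N (q * \sum_i eps i)%N.
    by clear; lia.
  split=> // [i|].
    (* If eps_i = 0, the predecessor loses nothing at i, and Riemann-Hurwitz leaves a sum of at most
       2 delta. *)
    rewrite lt0n; apply/negP => /eqP eps0.
    have : (\sum_(j | j != i) eps j <= \sum_(j | j != i) (eps j).-1 + 2)%N.
      apply: (@leq_trans (\sum_(j | j != i) ((eps j).-1 + 1))).
        by apply: leq_sum => j _; rewrite addn1 leqSpred.
      by rewrite big_split sum1_card cardC1 card_ord.
    have := RH; rewrite (bigD1 i) //= eps0; have := sum_epsE; rewrite (bigD1 i) //= eps0.
    move: delta_gt0.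
    move: (\sum_(j | j != i) eps j)%N (\sum_(j | j != i) (eps j).-1)%N.
    by clear; lia.
  move: sum_b sum_a le_qd; rewrite hde sum_epsE; move: (\sum_i a i)%N.
  by move: (\sum_i _)%N; clear; lia.
by split.
Qed.

(** * Covers and forms *)

Section Evaluation.

Variable k : fieldType.
Implicit Types (f : ratmap k) (P Q : P1 k).

Lemma proj_pointP (a b : k) Q : (a != 0) || (b != 0) ->
  proj_point a b = Q <-> (if Q is Some c then a - c * b else b) = 0.
Proof.
rewrite /proj_point; case: (eqVneq b 0) => [->|b0] ab0; case: Q => [c|] //=.
- rewrite mulr0 subr0; split=> [//|a0].
  by rewrite a0 eqxx in ab0.
- split=> [[<-]|/subr0_eq ->]; first by rewrite divfK ?subrr.
  by rewrite mulfK.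
- by split=> // b0'; rewrite b0' eqxx in b0.
Qed.

Lemma size_num f : (size (num f) <= (degree f).+1)%N.
Proof. exact: leq_trans (leq_maxl _ _) (leqSpred _). Qed.

Lemma size_den f : (size (den f) <= (degree f).+1)%N.
Proof. exact: leq_trans (leq_maxr _ _) (leqSpred _). Qed.

Lemma num_den_neq0 f : (num f != 0) || (den f != 0).
Proof.
rewrite -negb_and; apply/negP => /andP[/eqP n0 /eqP d0].
by have := num_den_coprime f; rewrite n0 d0 coprimep0 -size_poly_eq1 size_poly0.
Qed.

Lemma top_coef_neq0 f :
  ((num f)`_(degree f) != 0) || ((den f)`_(degree f) != 0).
Proof.
have := num_den_neq0 f; rewrite /degree /maxn.
case: ltnP => [lt_nd _|le_dn nd0].
  by rewrite -lead_coefE orbC lead_coef_eq0 -size_poly_gt0 (leq_ltn_trans _ lt_nd).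
rewrite -lead_coefE lead_coef_eq0.
by case/orP: nd0 => [-> //|]; rewrite -!size_poly_gt0 => /leq_trans ->.
Qed.

Lemma horner_neq0 f a : ((num f).[a] != 0) || ((den f).[a] != 0).
Proof.
rewrite -negb_and; apply/negP => /andP[n0 d0].
by have := coprimep_root (num_den_coprime f) n0; rewrite d0.
Qed.

Lemma eval_vanishes f P Q :
  eval f P = Q <-> vanishes (degree f) P 1 (fiber_form Q (num f) (den f)).
Proof.
case: P => [a|] /=.
  rewrite expr1 dvdp_XsubCl (proj_pointP _ (horner_neq0 f a)) rootE.
  by case: Q => [c|] /=; rewrite ?hornerE; split=> /eqP.
rewrite (proj_pointP _ (top_coef_neq0 f)) subn1 /=.
have sF := size_fiber_form Q (size_num f) (size_den f).
have <- : (fiber_form Q (num f) (den f))`_(degree f) =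
    if Q is Some c then (num f)`_(degree f) - c * (den f)`_(degree f)
    else (den f)`_(degree f).
  by case: Q {sF} => [c|] //=; rewrite coefB coefZ.
split=> [F0|/leq_sizeP -> //]; apply/leq_sizeP => j.
rewrite leq_eqVlt => /predU1P[<- //|ltj].
by rewrite nth_default // (leq_trans sF).
Qed.

(** The order subtracted in [ord] drops out: by coprimality the other form does not vanish at [P],
    which at infinity means that it has full size. *)
Lemma ram_index_form_ord f P : fiber_form (eval f P) (num f) (den f) != 0 ->
  ram_index f P = (form_ord (degree f) P (fiber_form (eval f P) (num f) (den f)))%:Z.
Proof.
have sN := size_num f; have sD := size_den f.
rewrite /ram_index; case: P => [a|] /=; rewrite /proj_point.
  case: (eqVneq (den f).[a] 0) => [d0|d0] /= F0.
    rewrite (@mupNroot _ a (num f)) ?subr0 // rootE.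
    by have := horner_neq0 f a; rewrite d0 eqxx orbF.
  by rewrite (@mupNroot _ a (den f)) ?subr0.
have size_top (A : {poly k}) : (size A <= (degree f).+1)%N ->
    A`_(degree f) != 0 -> size A = (degree f).+1.
  move=> sA A0; apply/eqP; rewrite eqn_leq sA ltnNge.
  by apply: contra A0 => /leq_sizeP ->.
case: (eqVneq (den f)`_(degree f) 0) => [d0|d0] /= F0.
  have n0 : (num f)`_(degree f) != 0.
    by have := top_coef_neq0 f; rewrite d0 eqxx orbF.
  by rewrite (size_top _ sN n0) subzn.
rewrite (size_top _ sD d0) subzn //.
exact: (@size_fiber_form _ _ (Some _)).
Qed.

End Evaluation.

Lemma cover_forms (k : closedFieldType) d (e : 'I_3 -> nat) (Q : 'I_3 -> P1 k)
    (f : ratmap k) : injective Q -> is_cover d e Q f ->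
  exists P : 'I_3 -> P1 k, [/\ injective P, degree f = d,
    wronskian (num f) (den f) != 0 &
    forall i, vanishes d (P i) (e i) (fiber_form (Q i) (num f) (den f))].
Proof.
move=> injQ [<- /separable_wronskian W0 ramQ].
have [P evP] := fin_all_exists ramQ.
exists P; split=> // [i j eqP|i].
  by apply: injQ; have [<- _ _] := evP i; have [<- _ _] := evP j; rewrite eqP.
have [eP ramP _] := evP i; have F0 := wronskian_fiber_form (Q i) W0.
move: ramP; rewrite ram_index_form_ord eP // => -[<-].
by rewrite vanishesE ?size_fiber_form ?size_num ?size_den.
Qed.

Lemma forms_cover (k : closedFieldType) p d (e : 'I_3 -> nat)
    (P Q : 'I_3 -> P1 k) (f : ratmap k) :
  p \in [pchar k] -> (forall i, 0 < e i)%N -> (\sum_i e i = 2 * d + 1)%N ->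
  injective P -> injective Q -> degree f = d -> wronskian (num f) (den f) != 0 ->
  (forall i, form_ord d (P i) (fiber_form (Q i) (num f) (den f)) = e i) ->
  is_cover d e Q f.
Proof.
move=> hp he hde injP injQ degf W0 ordP.
have F0 i : fiber_form (Q i) (num f) (den f) != 0 by apply: wronskian_fiber_form.
have sF i : (size (fiber_form (Q i) (num f) (den f)) <= d.+1)%N.
  by rewrite size_fiber_form // -degf ?size_num ?size_den.
have evP i : eval f (P i) = Q i.
  by apply/eval_vanishes; rewrite degf vanishesE // ordP.
split=> [||i] //; first exact: wronskian_separable hp W0.
exists (P i); split=> [||P' evP' neqP] //.
  by rewrite ram_index_form_ord evP // degf ordP.
rewrite ram_index_form_ord evP' // degf; congr Posz.
(* The terms e_j - 1 at the P_j already exhaust the bound 2 d - 2 of Riemann-Hurwitz, so a further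
   preimage contributes 0. *)
pose s := (P', Q i) :: [seq (P j, Q j) | j <- enum 'I_3].
have us : uniq (unzip1 s).
  rewrite /unzip1 /= -map_comp map_inj_uniq ?enum_uniq // andbT.
  apply/negP => /mapP[j _ P'j]; apply: neqP.
  by rewrite P'j; congr P; apply: injQ; rewrite -evP -evP' P'j.
have sN : (size (num f) <= d.+1)%N by rewrite -degf size_num.
have sD : (size (den f) <= d.+1)%N by rewrite -degf size_den.
have := riemann_hurwitz W0 sN sD us; rewrite big_cons big_map big_enum /=.
rewrite (eq_bigr (fun j => (e j).-1)) => [|j _]; last by rewrite ordP.
have ord_gt0 : (0 < form_ord d P' (fiber_form (Q i) (num f) (den f)))%N.
  by rewrite -vanishesE // -degf; apply/eval_vanishes.
have : (\sum_j (e j).-1 + 3 = 2 * d + 1)%N.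
  rewrite -hde [in RHS](eq_bigr (fun j => (e j).-1 + 1)%N) => [|j _].
    by rewrite big_split sum1_card card_ord.
  by rewrite addn1 prednK.
move: ord_gt0; move: (form_ord _ _ _) (\sum_j (e j).-1)%N; clear; lia.
Qed.

(** The ramification points are prescribed as well, so that degree 1 yields Mobius transformations
    between triples of points. *)
Lemma exists_cover_at (k : closedFieldType) p d (e : 'I_3 -> nat)
    (P Q : 'I_3 -> P1 k) :
  p \in [pchar k] -> (\sum_i e i = 2 * d + 1)%N -> (forall i, e i <= d)%N ->
  injective P -> injective Q -> numerically_admissible p d e ->
  exists f : ratmap k, [/\ degree f = d, wronskian (num f) (den f) != 0 &
    forall i, form_ord d (P i) (fiber_form (Q i) (num f) (den f)) = e i].
Proof.
move=> hp hde hed injP injQ adm.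
have [|N [D [sN sD ND0 vND]]] := @exists_forms k d e P Q; first by rewrite hde.
have [m [F [G [Q' []]]]] := forms_analysis hp hde hed injP injQ sN sD ND0 vND.
move=> [coFG W0] Q'E [delta_gt0 le_qd] [].
set q := (p ^ m)%N in Q'E le_qd *.
set delta := (maxn _ _).-1 in delta_gt0 le_qd *.
pose eps i := form_ord delta (P i) (fiber_form (Q' i) F G).
rewrite -/(eps _) => sum_eps eps_gt0 ltq.
have lt_i i : ((q * eps i - e i) + (e i - q * eps i) < q)%N.
  apply: leq_ltn_trans ltq; rewrite (bigD1 i) //=.
  by rewrite leq_addr.
(* For [q = 1] the total difference is less than 1, so the orders are exactly the e_i. *)
have [m0|m_gt0] := posnP m.
  have q1 : q = 1%N by rewrite /q m0 expn0.
  have eps_e i : eps i = e i by have := lt_i i; rewrite q1 !mul1n; clear; lia.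
  have deltaE : delta = d.
    move: sum_eps; rewrite (eq_bigr e) => [|i _]; last exact: eps_e.
    by rewrite hde; clear; lia.
  exists (RatMap coFG); split=> //= i; rewrite -eps_e /eps deltaE.
  by have := Q'E i F G; rewrite q1 !expr1 => ->.
(* As |q eps_i - e_i| < q, eps_i is the floor of e_i / q on [S] and the ceiling off [S]. *)
pose S := [set i | q * eps i < e i]%N.
have bar_downE i : i \in S -> bar_down p m (e i) = eps i.
  rewrite inE /bar_down -/q => lt_e; have := lt_i i => lt_q.
  have -> : e i = (eps i * q + (e i - q * eps i))%N by rewrite mulnC subnKC // ltnW.
  by rewrite divnMDl ?divn_small ?addn0 //; move: lt_q; clear; lia.
have bar_upE i : i \notin S -> bar_up p m (e i) = eps i.
  rewrite inE -leqNgt /bar_up -/q => le_e; have := lt_i i => lt_q.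
  have -> : (e i + q.-1 = eps i * q + (q.-1 - (q * eps i - e i)))%N.
    by move: le_e lt_q; rewrite [(eps i * q)%N]mulnC; clear; lia.
  by rewrite divnMDl ?divn_small ?addn0 //; move: lt_q; clear; lia.
have sumE : (\sum_(i in S) bar_down p m (e i) + \sum_(i in ~: S) bar_up p m (e i) =
    \sum_i eps i)%N.
  rewrite sum_in_setC; apply: eq_bigr => i _.
  by case: ifPn => [/bar_downE|/bar_upE].
have le_q : (p ^ m <= d)%N by rewrite (leq_trans _ le_qd) // leq_pmulr.
have lt_S i : i \in S -> (p ^ m < e i)%N.
  by rewrite inE; apply: leq_ltn_trans; rewrite leq_pmulr // eps_gt0.
have := adm m S m_gt0 le_q lt_S.
rewrite sumE sum_eps addn1 oddS mul2n odd_double sum_in_setC => /(_ isT).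
rewrite leqNgt => /negP[]; apply: leq_ltn_trans ltq; apply: leq_sum => i _.
case: ifPn => iS; rewrite /rem_down /rem_up -/q ?bar_downE ?bar_upE //.
  by rewrite leq_addl.
by rewrite leq_addr.
Qed.

(** * Mobius transformations *)

(** The value at (x, y) of the form of degree [n] represented by [F]. The map [iota] covers both
    scalar arguments and the substitution of polynomials. *)
Definition form_eval (R : nzRingType) (k : nzRingType) (iota : k -> R) n
    (F : {poly k}) (x y : R) : R :=
  \sum_(i < n.+1) iota F`_i * (x ^+ i * y ^+ (n - i)).

Definition form_comp (k : fieldType) n (F U V : {poly k}) : {poly k} :=
  form_eval polyC n F U V.

(** * Values and zeros of forms under substitution of linear forms *)

Section Substitution.

Variable k : fieldType.
Implicit Types (P Q : P1 k) (F G U V N D : {poly k}) (x y t : k).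

Definition coords P : k * k := if P is Some a then (a, 1) else (1, 0).

Definition value n F P : k := if P is Some a then F.[a] else F`_n.

Lemma form_eval_value n F P : (size F <= n.+1)%N ->
  form_eval id n F (coords P).1 (coords P).2 = value n F P.
Proof.
move=> sF; case: P => [a|] /=.
  rewrite (horner_coef_wide a sF); apply: eq_bigr => i _.
  by rewrite expr1n mulr1.
rewrite /form_eval big_ord_recr /= subnn expr1n !mulr1 big1 ?add0r // => i _.
by rewrite expr0n subn_eq0 leqNgt ltn_ord !mulr0.
Qed.

Lemma form_eval_scale n F t x y :
  form_eval id n F (t * x) (t * y) = t ^+ n * form_eval id n F x y.
Proof.
rewrite /form_eval big_distrr /=; apply: eq_bigr => i _.
have -> : t ^+ n = t ^+ i * t ^+ (n - i) by rewrite -exprD subnKC // -ltnS.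
by rewrite !exprMn; ring.
Qed.

Lemma proj_point_coords x y : (x != 0) || (y != 0) ->
  exists2 t, t != 0 &
    x = t * (coords (proj_point x y)).1 /\ y = t * (coords (proj_point x y)).2.
Proof.
rewrite /proj_point; case: (eqVneq y 0) => [->|y0] xy0 /=.
  by rewrite orbF in xy0; exists x; rewrite ?mulr1 ?mulr0.
by exists y; rewrite ?mulr1 // mulrCA divff ?mulr1.
Qed.

Lemma proj_point_coordsK P : proj_point (coords P).1 (coords P).2 = P.
Proof. by case: P => [a|]; rewrite /proj_point /= ?oner_eq0 ?eqxx ?divr1. Qed.

Lemma coords_neq0 P : ((coords P).1 != 0) || ((coords P).2 != 0).
Proof. by case: P => [a|] /=; rewrite oner_neq0 ?orbT. Qed.

Lemma proj_point_eq a b c e : (a != 0) || (b != 0) -> (c != 0) || (e != 0) ->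
  a * e = c * b -> proj_point a b = proj_point c e :> P1 k.
Proof.
rewrite /proj_point; case: (eqVneq b 0) => [->|b0]; case: (eqVneq e 0) => [->|e0] //.
- rewrite orbF mulr0 => a0 _ /eqP.
  by rewrite mulf_eq0 (negbTE a0) (negbTE e0).
- rewrite orbF mulr0 => _ c0 /esym/eqP.
  by rewrite mulf_eq0 (negbTE c0) (negbTE b0).
by move=> _ _ E; congr Some; apply/eqP; rewrite eqr_div // E.
Qed.

Lemma evalE (f : ratmap k) P :
  eval f P = proj_point (value (degree f) (num f) P) (value (degree f) (den f) P).
Proof. by case: P. Qed.

Lemma value_neq0 (f : ratmap k) P :
  (value (degree f) (num f) P != 0) || (value (degree f) (den f) P != 0).
Proof. by case: P => [a|] /=; rewrite ?horner_neq0 ?top_coef_neq0. Qed.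

Lemma form_eval_neq0 (f : ratmap k) x y : (x != 0) || (y != 0) ->
  (form_eval id (degree f) (num f) x y != 0) ||
  (form_eval id (degree f) (den f) x y != 0).
Proof.
move=> /proj_point_coords[t t0 []]; move: (proj_point x y) => P -> ->.
rewrite !form_eval_scale.
rewrite !form_eval_value ?size_num ?size_den // !mulf_eq0 !expf_eq0 (negbTE t0) !andbF.
exact: value_neq0.
Qed.

Lemma eval_proj_point (f : ratmap k) x y : (x != 0) || (y != 0) ->
  eval f (proj_point x y) =
  proj_point (form_eval id (degree f) (num f) x y)
             (form_eval id (degree f) (den f) x y).
Proof.
move=> xy0; rewrite evalE; have [t t0 [xE yE]] := proj_point_coords xy0.
apply: proj_point_eq; [exact: value_neq0 | exact: form_eval_neq0 |].
move: (proj_point x y) xE yE => P -> ->.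
rewrite !form_eval_scale !form_eval_value ?size_num ?size_den //.
ring.
Qed.

Lemma coef_top_mul m n F G : (size F <= m.+1)%N -> (size G <= n.+1)%N ->
  (F * G)`_(m + n) = F`_m * G`_n.
Proof.
move=> sF sG; have le_m : (m < (m + n).+1)%N by rewrite ltnS leq_addr.
rewrite coefM (bigD1 (Ordinal le_m)) //= addKn big1 ?addr0 // => i neq_im.
have [lt_im|lt_mi|eq_im] := ltngtP i m.
- rewrite [G`__]nth_default ?mulr0 //; apply: leq_trans sG _.
  by have := ltn_ord i; lia.
- by rewrite nth_default ?mul0r // (leq_trans sF).
by case/eqP: neq_im; apply: val_inj.
Qed.

Lemma valueM m n F G P : (size F <= m.+1)%N -> (size G <= n.+1)%N ->
  value (m + n) (F * G) P = value m F P * value n G P.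
Proof.
by case: P => [a|] sF sG /=; [rewrite hornerM | rewrite coef_top_mul].
Qed.

Lemma valueX m n F P : (size F <= n.+1)%N -> value (m * n) (F ^+ m) P = value n F P ^+ m.
Proof.
move=> sF; elim: m => [|m IHm].
  by case: P => [a|]; rewrite !expr0 mul0n /= ?hornerC // coef1.
by rewrite !exprS mulSn valueM ?size_form_exp // IHm.
Qed.

Lemma size_form_comp n F U V : (size U <= 2)%N -> (size V <= 2)%N ->
  (size (form_comp n F U V) <= n.+1)%N.
Proof.
move=> sU sV; apply: (leq_trans (size_sum _ _ _)); apply/bigmax_leqP => i _.
rewrite mul_polyC (leq_trans (size_scale_leq _ _)) //.
have := size_formM (size_form_exp i sU) (size_form_exp (n - i) sV).
by rewrite !muln1 subnKC // -ltnS.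
Qed.

Lemma value_form_comp n F U V P : (size U <= 2)%N -> (size V <= 2)%N ->
  value n (form_comp n F U V) P = form_eval id n F (value 1 U P) (value 1 V P).
Proof.
move=> sU sV.
have -> : value n (form_comp n F U V) P =
    \sum_(i < n.+1) value n ((F`_i)%:P * (U ^+ i * V ^+ (n - i))) P.
  by case: P => [a|] /=; rewrite ?horner_sum ?coef_sum.
apply: eq_bigr => i _; have le_in : (i <= n)%N by rewrite -ltnS.
rewrite -{1}[n]add0n valueM ?size_polyC ?leq_b1 //; last first.
  have := size_formM (size_form_exp i sU) (size_form_exp (n - i) sV).
  by rewrite !muln1 subnKC.
have := valueM P (size_form_exp i sU) (size_form_exp (n - i) sV).
rewrite !valueX // !muln1 subnKC // => ->; congr (_ * _).
by case: P => [a|] /=; rewrite ?hornerC // coefC eqxx.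
Qed.

Lemma form_compB n c F G U V :
  form_comp n (F - c *: G) U V = form_comp n F U V - c *: form_comp n G U V.
Proof.
rewrite /form_comp /form_eval scaler_sumr -sumrB; apply: eq_bigr => i _.
by rewrite coefB coefZ polyCB polyCM -mul_polyC; ring.
Qed.

Lemma fiber_form_comp n Q N D U V :
  fiber_form Q (form_comp n N U V) (form_comp n D U V) =
  form_comp n (fiber_form Q N D) U V.
Proof. by case: Q => [c|] //=; rewrite form_compB. Qed.

Lemma form_compS n F U V : (size F <= n.+1)%N ->
  form_comp n.+1 F U V = V * form_comp n F U V.
Proof.
move=> sF; rewrite /form_comp /form_eval big_ord_recr /= nth_default // mul0r addr0.
rewrite big_distrr /=; apply: eq_bigr => i _.
by rewrite subSn -1?ltnS // exprS; ring.
Qed.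

Lemma form_comp_mulX n F U V :
  form_comp n.+1 (F * 'X) U V = U * form_comp n F U V.
Proof.
rewrite /form_comp /form_eval big_ord_recl coefMX /= mul0r add0r big_distrr /=.
by apply: eq_bigr => i _; rewrite coefMX /= subSS exprS; ring.
Qed.

(** The linear form of [P] pulls back to the fibre form over [P]. At infinity its factor 1 still
    raises the degree, which contributes [V]. *)
Lemma form_comp_linear n P F U V : (size F <= n.+1)%N ->
  form_comp n.+1 (F * linear_form P) U V = fiber_form P U V * form_comp n F U V.
Proof.
move=> sF; case: P => [a|] /=; last by rewrite mulr1 form_compS.
rewrite mulrBr [F * a%:P]mulrC mul_polyC form_compB form_comp_mulX form_compS //.
by rewrite -!mul_polyC; ring.
Qed.

Lemma form_comp_linearX n P e F U V : (size F <= n.+1)%N ->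
  form_comp (e + n) (F * linear_form P ^+ e) U V =
  fiber_form P U V ^+ e * form_comp n F U V.
Proof.
move=> sF; elim: e => [|e IHe]; first by rewrite !expr0 mul1r mulr1.
rewrite exprSr mulrA addSn form_comp_linear ?IHe ?exprS ?mulrA //.
have := size_formM sF (size_form_exp e (size_linear_form P)).
by rewrite muln1 addnC.
Qed.

Lemma vanishes_factor n P e F : F != 0 -> (size F <= n.+1)%N -> vanishes n P e F ->
  exists n' G, [/\ n = (e + n')%N, F = G * linear_form P ^+ e & (size G <= n'.+1)%N].
Proof.
rewrite -size_poly_gt0 => F_gt0 sF; case: P => [a|] /= vF; last first.
  by exists (n - e)%N, F; rewrite expr1n mulr1; split=> //; size_lia.
have [G FE] := dvdpP _ _ vF; exists (n - e)%N, G.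
have G0 : G != 0 by apply: contraTneq F_gt0 => G0; rewrite FE G0 mul0r size_poly0.
have := sF; rewrite {1}FE size_mul ?expf_neq0 ?polyXsubC_eq0 // size_exp_XsubC addnS /=.
by rewrite -size_poly_gt0 in G0; split=> //; size_lia.
Qed.

(** [F] has the e-th power of the linear form of [P] as a factor, and this pulls back to the e-th
    power of a form vanishing at [P']. *)
Lemma vanishes_form_comp n P P' e F U V :
  (size F <= n.+1)%N -> (size U <= 2)%N -> (size V <= 2)%N ->
  vanishes n P e F -> vanishes 1 P' 1 (fiber_form P U V) ->
  vanishes n P' e (form_comp n F U V).
Proof.
move=> sF sU sV vF vUV; have [F0|F0] := eqVneq F 0.
  rewrite F0 (_ : form_comp n 0 U V = 0) ?vanishes0 //.
  by rewrite /form_comp /form_eval big1 // => i _; rewrite coef0 mul0r.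
have [n' [G [-> -> sG]]] := vanishes_factor F0 sF vF.
rewrite form_comp_linearX // vanishesMr ?size_form_comp //.
by have := vanishesX e vUV; rewrite !muln1.
Qed.

End Substitution.

(** The Wronskian of two linear forms is the determinant of their coefficients. *)
Lemma degree1_automorphism (k : fieldType) (s : ratmap k) :
  degree s = 1%N -> wronskian (num s) (den s) != 0 -> automorphism s.
Proof.
move=> deg_s W0; have sN := size_num s; have sD := size_den s; rewrite deg_s in sN sD.
set a := (num s)`_1; set b := (num s)`_0; set c := (den s)`_1; set e := (den s)`_0.
have linE (F : {poly k}) : (size F <= 2)%N -> F = F`_1 *: 'X + (F`_0)%:P.
  move=> sF; apply/polyP => i; rewrite coefD coefZ coefX coefC.
  case: i => [|[|i]] /=; rewrite ?mulr0 ?mulr1 ?addr0 ?add0r //.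
  by rewrite nth_default // (leq_trans sF).
have det0 : a * e - b * c != 0.
  apply: contra_neq W0 => det0.
  rewrite (linE _ sN) (linE _ sD) -/a -/b -/c -/e /wronskian !derivD !derivZ !derivX !derivC.
  have -> : (a *: 1 + 0) * (c *: 'X + e%:P) - (a *: 'X + b%:P) * (c *: 1 + 0) =
      (a * e - b * c)%:P by rewrite polyCB !polyCM -!mul_polyC; ring.
  by rewrite det0.
(* The adjugate matrix, inverse to [s] up to the determinant. *)
pose N := e *: 'X - b%:P; pose D := - c *: 'X + a%:P.
have coND : coprimep N D.
  apply/Bezout_coprimepP; exists (c%:P, e%:P).
  have -> : c%:P * N + e%:P * D = (a * e - b * c)%:P.
    by rewrite /N /D polyCB !polyCM -!mul_polyC polyCN; ring.
  by rewrite -size_poly_eq1 size_polyC det0.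
pose t := RatMap coND.
have evalF (F : {poly k}) x y : form_eval id 1 F x y = F`_1 * x + F`_0 * y.
  by rewrite /form_eval !big_ord_recl big_ord0 /= !expr1 !expr0; ring.
have [N1 N0 D1 D0] : [/\ N`_1 = e, N`_0 = - b, D`_1 = - c & D`_0 = a].
  by rewrite /N /D !coefD !coefN !coefZ !coefX !coefC /= !mulr1 !mulr0; split; ring.
have deg_t : degree t = 1%N.
  have sNt : (size N <= 2)%N.
    apply/leq_sizeP => -[|[|j]] // _.
    by rewrite /N coefD coefN coefZ coefX coefC mulr0 subr0.
  have sDt : (size D <= 2)%N.
    apply/leq_sizeP => -[|[|j]] // _.
    by rewrite /D coefD coefZ coefX coefC mulr0 addr0.
  have : (1 < maxn (size N) (size D))%N.
    rewrite leq_max; apply: contraNT det0; rewrite negb_or -!leqNgt.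
    case/andP=> /leq_sizeP/(_ 1%N (leqnn _)); rewrite N1 => ->.
    move=> /leq_sizeP/(_ 1%N (leqnn _)); rewrite D1 => /eqP; rewrite oppr_eq0 => /eqP->.
    by rewrite !mulr0 subr0.
  rewrite /degree /=; move: sNt sDt; rewrite /maxn; case: ifP => _; size_lia.
have cancelE (f g : ratmap k) : degree f = 1%N -> degree g = 1%N ->
    (forall x y, form_eval id 1 (num g) (form_eval id 1 (num f) x y)
       (form_eval id 1 (den f) x y) = (a * e - b * c) * x) ->
    (forall x y, form_eval id 1 (den g) (form_eval id 1 (num f) x y)
       (form_eval id 1 (den f) x y) = (a * e - b * c) * y) ->
    cancel (eval f) (eval g).
  move=> degf degg gx gy P; rewrite -[P in eval f P]proj_point_coordsK.
  rewrite eval_proj_point ?coords_neq0 // eval_proj_point ?form_eval_neq0 ?coords_neq0 //.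
  rewrite degf degg gx gy -[RHS]proj_point_coordsK.
  apply: proj_point_eq; rewrite ?coords_neq0 //; last by ring.
  by rewrite !mulf_eq0 (negbTE det0) coords_neq0.
exists t; split; apply: cancelE => //= x y; rewrite !evalF ?N1 ?N0 ?D1 ?D0 -/a -/b -/c -/e; ring.
Qed.

(** A Mobius transformation [s] takes the ramification points of [g] to those of [f]; the pull-back
    of [f] along [s] then has the orders of [g] required by [cross_eq0]. *)
Lemma cover_unique (k : closedFieldType) p d (e : 'I_3 -> nat) (Q : 'I_3 -> P1 k)
    (f g : ratmap k) :
  p \in [pchar k] -> (\sum_i e i = 2 * d + 1)%N -> injective Q ->
  is_cover d e Q f -> is_cover d e Q g ->
  exists s : ratmap k, automorphism s /\ forall P, eval g P = eval f (eval s P).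
Proof.
move=> hp hde injQ /cover_forms-/(_ injQ)[P [injP degf Wf vf]].
move=> /cover_forms-/(_ injQ)[P' [injP' degg Wg vg]].
(* In degree 1 the condition p^m <= 1 fails for m > 0, so (1, 1, 1) is vacuously admissible and
   [exists_cover_at] supplies [s]. *)
have adm1 : numerically_admissible p 1 (fun _ => 1%N).
  move=> m S m_gt0 le1; have := ltn_expl m (prime_gt1 (pcharf_prime hp)).
  by rewrite ltnNge (leq_trans le1).
have sum1 : (\sum_(i < 3) 1 = 2 * 1 + 1)%N by rewrite sum1_card card_ord.
have [s [deg_s Ws ords]] :=
  exists_cover_at hp sum1 (fun _ => leqnn _) injP' injP adm1.
have sU := size_num s; have sV := size_den s; rewrite deg_s in sU sV.
have vs i : vanishes 1 (P' i) 1 (fiber_form (P i) (num s) (den s)).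
  by rewrite vanishesE ?ords ?size_fiber_form ?wronskian_fiber_form.
exists s; split; first exact: degree1_automorphism.
have sNf := size_num f; have sDf := size_den f; rewrite degf in sNf sDf.
have sNg := size_num g; have sDg := size_den g; rewrite degg in sNg sDg.
pose N := form_comp d (num f) (num s) (den s).
pose D := form_comp d (den f) (num s) (den s).
have E : num g * D = N * den g.
  apply: (@cross_eq0 k _ d e P' Q) => //; rewrite ?size_form_comp //.
    by rewrite hde addn1.
  move=> i; rewrite fiber_form_comp; apply: (@vanishes_form_comp _ _ (P i)) => //.
  by rewrite size_fiber_form.
move=> R; have value_s := value_neq0 s R; rewrite deg_s in value_s.
have valueE (F : {poly k}) : value d (form_comp d F (num s) (den s)) R =
    form_eval id d F (value 1 (num s) R) (value 1 (den s) R).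
  by rewrite value_form_comp.
rewrite [eval s R]evalE deg_s eval_proj_point // degf evalE degg -!valueE -/N -/D.
apply: proj_point_eq.
- by have := value_neq0 g R; rewrite degg.
- by rewrite !valueE -degf form_eval_neq0.
by rewrite -!valueM ?size_form_comp // E.
Qed.

(* Existence, admissibility and uniqueness combined *)
Local Close Scope ring_scope.

Theorem theorem2p4 (k : closedFieldType) (p : nat) (hp : p \in [pchar k]%R)
    (d : nat) (e : 'I_3 -> nat) (Q : 'I_3 -> P1 k)
    (hd : 0 < d) (he : forall i, 0 < e i)
    (hde : 2 * d - 2 = \sum_(i < 3) (e i - 1))
    (hep : forall i, coprime p (e i))
    (hed : forall i, e i <= d)
    (hQ : injective Q) :
  (numerically_admissible p d e <->
     exists f : ratmap k, is_cover d e Q f) /\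
  (forall f g : ratmap k, is_cover d e Q f -> is_cover d e Q g ->
     exists s : ratmap k, automorphism s /\
       forall P : P1 k, eval g P = eval f (eval s P)).
Proof.
have sum_e : \sum_i e i = 2 * d + 1.
  have : \sum_i e i = \sum_(i < 3) (e i - 1) + 3.
    rewrite (eq_bigr (fun i => e i - 1 + 1)) => [|i _]; last by rewrite subnK.
    by rewrite big_split sum1_card card_ord.
  by rewrite -hde => ->; lia.
split; last by move=> f g; apply: cover_unique hp sum_e hQ.
split=> [adm | [f cover_f]].
  (* Any three distinct points can serve as ramification points; the Q_i themselves are taken. *)
  have [f [deg_f Wf ord_f]] := exists_cover_at hp sum_e hed hQ hQ adm.
  by exists f; apply: (@forms_cover k p d e Q).
have [P [injP deg_f Wf vf]] := cover_forms hQ cover_f.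
by apply: (forms_admissible hp sum_e injP _ _ Wf vf); rewrite -deg_f ?size_num ?size_den.
Qed.
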